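(* If $q$ is odd and fixed, then, for each choice of sign in $\Omega^{\pm}$, $$\lim_{m\to\infty}\frac{i(\Omega^{\pm}(4m,q))}{q^{(2m)^2}}=\frac14\left(\prod_{i\ge 1}(1+1/q^{2i-1})^2+\prod_{i\ge 1}(1-1/q^{2i-1})^2\right),$$ and $$\lim_{m\to\infty}\frac{i(\Omega^{\pm}(4m+2,q))}{q^{(2m+1)^2}}=\frac14\left(\prod_{i\ge 1}(1+1/q^{2i-1})^2-\prod_{i\ge 1}(1-1/q^{2i-1})^2\right).$$
   Context: For $q$ an odd prime power and $\delta$ a fixed nonsquare in $\mathbb{F}_q^{\times}$: $\mathrm{O}^{+}(2n,q)$ is the isometry group on $\mathbb{F}_q^{2n}$ of the quadratic form $x_1x_2+x_3x_4+\cdots+x_{2n-1}x_{2n}$, and $\mathrm{O}^{-}(2n,q)$ is that of $x_1x_2+\cdots+x_{2n-3}x_{2n-2}+x_{2n-1}^2-\delta x_{2n}^2$. $\mathrm{SO}^{\pm}(2n,q)$ is the subgroup of determinant $1$ elements of $\mathrm{O}^{\pm}(2n,q)$, and $\Omega^{\pm}(2n,q)$ is the derived subgroup of $\mathrm{SO}^{\pm}(2n,q)$ (of index $2$ in it for $n\ge 2$). $i(X)$ denotes the number of $g\in X$ with $g^2=1$ (the identity is counted). *)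

(* Defs.v *)
From HB Require Import structures.
From mathcomp Require Import all_boot all_order all_algebra all_fingroup.
From mathcomp Require Import ring.
From mathcomp Require Import all_classical all_reals all_analysis.

Set Implicit Arguments.
Unset Strict Implicit.
Unset Printing Implicit Defensive.

Import Order.TTheory GRing.Theory Num.Theory.
Import numFieldNormedType.Exports.

Local Open Scope ring_scope.

Variant sgn := Plus | Minus.

Section OrthogonalGroups.

Variables (F : finFieldType) (delta : F).

(* Coordinates are 0-based, and 'rV_(n.*2.-1.+1) is the space on which
   {'GL_(n.*2)[F]} acts; it is F^(2n) for n > 0, and meaningless for n = 0. *)
Definition qform (s : sgn) (n : nat) (x : 'rV[F]_(n.*2.-1.+1)) : F :=
  match s with
  | Plus => \sum_(i < n) x 0 (inord i.*2) * x 0 (inord i.*2.+1)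
  | Minus =>
      \sum_(i < n.-1) x 0 (inord i.*2) * x 0 (inord i.*2.+1)
      + x 0 (inord n.-1.*2) ^+ 2 - delta * x 0 (inord n.-1.*2.+1) ^+ 2
  end.

Definition Ogrp (s : sgn) (n : nat) : {set {'GL_(n.*2)[F]}} :=
  finset (fun g : {'GL_(n.*2)[F]} =>
    [forall x : 'rV[F]_(n.*2.-1.+1), qform s (x *m GLval g) == qform s x]).

Fact Ogrp_group_set s n : group_set (Ogrp s n).
Proof.
apply/group_setP; split=> [|g h].
  by rewrite inE; apply/forallP => x; rewrite GL_1E mulmx1.
rewrite !inE => /forallP gP /forallP hP; apply/forallP => x.
by rewrite GL_ME -mulmxE mulmxA (eqP (hP _)) (eqP (gP _)).
Qed.

Canonical Ogrp_group s n := Group (Ogrp_group_set s n).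

Definition SOgrp (s : sgn) (n : nat) : {set {'GL_(n.*2)[F]}} :=
  finset (fun g : {'GL_(n.*2)[F]} => (g \in Ogrp s n) && (\det (GLval g) == 1)).

Fact SOgrp_group_set s n : group_set (SOgrp s n).
Proof.
have memE g : (g \in SOgrp s n) = (g \in Ogrp s n) && (\det (GLval g) == 1).
  by rewrite finset.in_set.
apply/group_setP; split=> [|g h]; rewrite !memE.
  by rewrite group1 GL_1E det1 eqxx.
move=> /andP[gO /eqP g1] /andP[hO /eqP h1]; rewrite groupM //.
by rewrite GL_ME -mulmxE det_mulmx g1 h1 mulr1 eqxx.
Qed.

Canonical SOgrp_group s n := Group (SOgrp_group_set s n).

Definition Omega (s : sgn) (n : nat) : {set {'GL_(n.*2)[F]}} :=
  [~: SOgrp s n, SOgrp s n]%g.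

End OrthogonalGroups.

Definition num_sqrt1 (gT : finGroupType) (X : {set gT}) : nat :=
  #|[pred g in X | (g ^+ 2 == 1)%g]|.

Section InfiniteProduct.

Variable R : realType.

(* The product over i >= 1; lim is a default value when the partial products
   diverge, a case the two facts below exclude. *)
Definition infprod (u : nat -> R) : R :=
  limn (fun N : nat => \prod_(1 <= i < N.+1) u i).

Local Lemma term_bound (q : R) (i : nat) : 2 <= q -> (0 < i)%N ->
  0 <= 1 / q ^+ (2 * i - 1) <= 1 / 2 ^+ i.
Proof.
move=> q2 i0; have q0 : 0 < q by exact: lt_le_trans q2.
rewrite !div1r invr_ge0 (exprn_ge0 _ (ltW q0)) /=.
rewrite lef_pV2 ?posrE ?exprn_gt0 //.
apply: (@le_trans _ _ (2 ^+ (2 * i - 1))); last first.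
  by apply: lerXn2r; rewrite // nnegrE ltW.
rewrite ler_eXn2l ?ltr1n //; case: i i0 => // i _.
by rewrite mul2n -addnn addnS subn1 leq_addr.
Qed.

Fact infprod_plus_cvg (q : R) : 2 <= q ->
  cvgn (fun N : nat => \prod_(1 <= i < N.+1) (1 + 1 / q ^+ (2 * i - 1)) ^+ 2).
Proof.
move=> q2; have tb := term_bound q2.
have p0 N : 0 <= \prod_(1 <= i < N.+1) (1 + 1 / q ^+ (2 * i - 1)) ^+ 2.
  by apply: prodr_ge0 => i _; rewrite sqr_ge0.
apply: nondecreasing_is_cvgn.
  apply/nondecreasing_seqP => N; rewrite [leRHS]big_nat_recr //=.
  rewrite ler_peMr ?p0 // exprn_ege1 // lerDl.
  by case/andP: (tb N.+1 isT).
exists (expR 2) => _ [N _ <-].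
apply: (@le_trans _ _ (expR (2 * (1 - 1 / 2 ^+ N)))); last first.
  rewrite ler_expR -[leRHS]mulr1 ler_pM2l //.
elim: N => [|N IH].
  by rewrite big_nil expr0 divr1 subrr mulr0 expR0.
rewrite big_nat_recr //=.
have -> : 2 * (1 - 1 / 2 ^+ N.+1) =
          2 * (1 - 1 / 2 ^+ N) + 1 / 2 ^+ N.+1 *+ 2 :> R.
  have : (2 : R) ^+ N != 0 by rewrite expf_neq0.
  by move=> h; rewrite exprS; field.
rewrite expRD -[1 / 2 ^+ N.+1 *+ 2]mulr_natr expRM_natr ler_pM ?p0 ?sqr_ge0 //.
have /andP[t0 t1] := tb N.+1 isT.
rewrite lerXn2r ?nnegrE ?addr_ge0 ?expR_ge0 //.
by apply: le_trans (expR_ge1Dx _); rewrite lerD2l.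
Qed.

Fact infprod_minus_cvg (q : R) : 2 <= q ->
  cvgn (fun N : nat => \prod_(1 <= i < N.+1) (1 - 1 / q ^+ (2 * i - 1)) ^+ 2).
Proof.
move=> q2; have tb := term_bound q2.
have p0 N : 0 <= \prod_(1 <= i < N.+1) (1 - 1 / q ^+ (2 * i - 1)) ^+ 2.
  by apply: prodr_ge0 => i _; rewrite sqr_ge0.
apply: nonincreasing_is_cvgn; last by exists 0 => _ [N _ <-].
apply/nonincreasing_seqP => N; rewrite [leLHS]big_nat_recr //=.
rewrite ler_piMr ?p0 //; have /andP[t0 t1] := tb N.+1 isT.
have h : 1 / 2 ^+ N.+1 <= 1 :> R.
  by rewrite div1r invf_le1 ?exprn_gt0 // exprn_ege1 // ler1n.
by rewrite exprn_ile1 ?subr_ge0 ?(le_trans t1 h) // gerBl.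
Qed.

End InfiniteProduct.

(* Main.v *)
(* An involution [g] of [SO(V)], [dim V = 2n], is determined by its [-1]-eigenspace
   [W], which is nondegenerate of even dimension [2k].  For [0 < k < n], [g] lies in
   the derived subgroup iff the discriminant of [W] is a square, i.e. iff [W] has
   an orthonormal basis.
   - If it is a square, [-1_W] is an explicit commutator.
   - Elements of the derived subgroup act as even permutations on the sphere
     [Q = 1]; the number of vectors moved by [g], computed modulo 4, shows that
     this fails when the discriminant of [W] is not a square.
   Hence the involutions with [dim W = 2k] are counted by orthonormal [2k]-frames
   of [V] modulo orthonormal [2k]-frames of [W].  With [x = 1/q] and signs
   [s_i, t_i], the count is
     [q^(4k(n-k)) 1/2 [n,k]_{x^2} (1 + s_{n-k} x^(n-k)) (1 + t_k x^k) / (1 + s_n x^n)],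
   and [4k(n-k) = n^2 - (n-2k)^2].  Up to an error tending to 0 the coefficient may be
   replaced by [1/2 [2n,2k]_{x^2}], and the resulting sum is evaluated exactly by
   the q-binomial theorem (a finite form of Jacobi's triple product). *)
Require Import Defs.
From HB Require Import structures.
From mathcomp Require Import all_boot all_order all_algebra all_fingroup.
From mathcomp Require Import finfield.
From mathcomp Require Import ring lra zify.

Set Implicit Arguments.
Unset Strict Implicit.
Unset Printing Implicit Defensive.

Import Order.TTheory GRing.Theory Num.Theory.

Local Open Scope ring_scope.

(** * The quadratic character and conics *)

(** The usual invariant that cuts the derived subgroup out of [SOgrp] is the spinor norm; the sign
    of the permutation of the unit sphere takes its place. It can be computed because |F| is
    congruent to the quadratic character of -1 modulo 4, which fixes all sphere sizes of
    even-dimensional spaces modulo 4. Whether -1 lies in the derived subgroup is left undecided: the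
    identity and -1 add at most 2, which is absorbed by the error. The binomial [2n,2k] is dictated
    by the product side: the q-binomial theorem with 2n factors has exponents 2nj - j^2, which is
    4k(n-k) at j = 2k. Averaging over z = 1 and z = -1 keeps the even j, and the factor z^n becomes
    the (-1)^n that separates the two limits. Replacing [n,k] by [2n,2k] costs O(x^k + x^(n-k)) in a
    term weighted by x^((n-2k)^2). Since (n-2k)^2 + min(k, n-k) is at least the integer part of n/2,
    the total error is O(n x^(n/2)). The type of the form enters only through signs inside factors 1
    + O(x^k) + O(x^(n-k)), so both types have the same limit. *)

Lemma Posz_sum (I : Type) (r : seq I) (P : pred I) (f : I -> nat) :
  (\sum_(i <- r | P i) f i)%N%:Z = \sum_(i <- r | P i) (f i)%:Z.
Proof. exact: (big_morph Posz PoszD). Qed.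

Section QuadraticCharacter.

Variable F : finFieldType.
Hypothesis hodd : odd #|F|.

Lemma two_neq0 : (2 : F) != 0.
Proof.
apply/negP => h2; have ch2 : 2%N \in [pchar F].
  by rewrite inE /=; exact: h2.
have := finNzRing_gt1 F; move: hodd; rewrite (card_pprimeChar ch2).
by case: (logn _ _) => // n; rewrite oddX.
Qed.

Lemma eq_opp0 (x : F) : (x == - x) = (x == 0).
Proof.
by rewrite -subr_eq0 opprK -mulr2n -mulr_natl mulf_eq0 (negPf two_neq0).
Qed.

Definition is_sq (a : F) : bool := [exists x, x ^+ 2 == a].

(** Valued in [int], so that the signs in the point counts live in the same ring as the
    cardinals. *)
Definition qchar (a : F) : int :=
  if a == 0 then 0 else if is_sq a then 1 else -1.

Lemma qchar0 : qchar 0 = 0. Proof. by rewrite /qchar eqxx. Qed.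

Lemma qchar_sq x : x != 0 -> qchar (x ^+ 2) = 1.
Proof.
move=> x0; rewrite /qchar sqrf_eq0 (negPf x0); case: ifP => // /existsP h.
by case: h; exists x.
Qed.

Lemma qchar1 : qchar 1 = 1.
Proof. by rewrite -(qchar_sq (oner_neq0 F)) expr1n. Qed.

Lemma qchar_pm a : a != 0 -> qchar a = 1 \/ qchar a = -1.
Proof. by rewrite /qchar => /negPf ->; case: ifP; auto. Qed.

Lemma qcharP a : a != 0 -> qchar a = 1 -> exists2 x, x != 0 & a = x ^+ 2.
Proof.
rewrite /qchar => a0; rewrite (negPf a0); case: ifP => // /existsP[x /eqP xa] _.
by exists x => //; apply: contraNneq a0 => x0; rewrite -xa x0 expr0n.
Qed.

Lemma card_sqrt a : #|[set x : F | x ^+ 2 == a]|%:Z = 1 + qchar a.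
Proof.
have [->|a0] := eqVneq a 0.
  rewrite qchar0 addr0 (_ : [set x | _] = [set 0]) ?cards1 //.
  by apply/setP => x; rewrite !inE sqrf_eq0.
rewrite /qchar (negPf a0); case: ifP => [/existsP[y /eqP ya]|/existsP h].
  have y0 : y != 0 by apply: contraNneq a0 => y0; rewrite -ya y0 expr0n.
  rewrite (_ : [set x | _] = [set y; - y]) ?cards2 ?eq_opp0 ?y0 //.
  by apply/setP => x; rewrite !inE -ya eqf_sqr.
rewrite (_ : [set x | _] = set0) ?cards0 //.
by apply/setP => x; rewrite !inE; apply/negbTE/negP => xa; apply: h; exists x.
Qed.

Lemma sum_qchar : \sum_a qchar a = 0.
Proof.
have : \sum_a #|[set x : F | x ^+ 2 == a]|%:Z = #|F|%:Z.
  rewrite -[#|F|]sum1_card [in RHS](partition_big (fun x : F => x ^+ 2) predT) //= Posz_sum.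
  by apply: eq_bigr => a _; rewrite sum1dep_card.
rewrite (eq_bigr _ (fun a _ => card_sqrt a)) big_split /= -[X in _ = X]addr0.
by rewrite sumr_const natz => /addrI.
Qed.

(** For a nonsquare [a], each [qchar c + qchar (a * c)] is at most 0, because [c] and [a * c] cannot
    both be nonzero squares. The sum over all [c] is 0, so every term vanishes. *)
Lemma qcharM a b : a != 0 -> b != 0 -> qchar (a * b) = qchar a * qchar b.
Proof.
move=> a0 b0.
wlog : / qchar a = -1 => [th|an].
  case: (qchar_pm a0) => [a1|]; last exact: th.
  have [x x0 ->] := qcharP a0 a1; rewrite qchar_sq // mul1r.
  case: (qchar_pm b0) => [b1|bn].
    by have [y y0 ->] := qcharP b0 b1; rewrite -exprMn !qchar_sq ?mulf_neq0.
  rewrite bn /qchar mulf_eq0 sqrf_eq0 (negPf x0) (negPf b0) /=.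
  case: ifP => // /existsP[y /eqP yE].
  have : is_sq b.
    by apply/existsP; exists (y / x); rewrite exprMn yE exprVn mulrAC divff ?mul1r ?sqrf_eq0.
  by move: bn; rewrite /qchar (negPf b0) => + h; rewrite h.
rewrite an mulN1r.
have s0 : \sum_c - (qchar c + qchar (a * c)) = 0.
  have -> : \sum_c - (qchar c + qchar (a * c)) = - (\sum_c qchar c + \sum_c qchar c).
    rewrite sumrN big_split /=; congr (- (_ + _)).
    by rewrite [RHS](reindex_inj (mulfI a0)).
  by rewrite sum_qchar addr0 oppr0.
have ge0 c : true -> 0 <= - (qchar c + qchar (a * c)).
  move=> _; have [->|c0] := eqVneq c 0; first by rewrite mulr0 qchar0.
  have ac0 : a * c != 0 by rewrite mulf_neq0.
  case: (qchar_pm c0) => c1; last by case: (qchar_pm ac0) => ->; rewrite c1.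
  suff -> : qchar (a * c) = -1 by rewrite c1.
  case: (qchar_pm ac0) => // ac1.
  have [x x0 xE] := qcharP ac0 ac1; have [y y0 yE] := qcharP c0 c1.
  have : is_sq a.
    apply/existsP; exists (x / y).
    by rewrite exprMn -xE exprVn -yE mulfK.
  by move: an; rewrite /qchar (negPf a0) => + h; rewrite h.
move/eqP: s0; rewrite psumr_eq0 // => /allP/(_ b (mem_index_enum b)) /=.
by rewrite oppr_eq0 addrC addr_eq0 => /eqP.
Qed.

Lemma qcharMsq a x : x != 0 -> qchar (a * x ^+ 2) = qchar a.
Proof.
move=> x0; have [->|a0] := eqVneq a 0; first by rewrite mul0r.
by rewrite qcharM ?sqrf_eq0 // qchar_sq // mulr1.
Qed.

(** Write |F| = 2h + 1. For odd h, a square root x of -1 would satisfy 1 = x^(2h) = (-1)^h = -1. For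
    even h, a nonzero a with a^h different from 1 has a^h = -1, and a^h is a square. *)
Lemma qcharN1_mod4 : exists t : int, #|F|%:Z = qchar (-1) + 4 * t.
Proof.
have q1 := finNzRing_gt1 F.
have qE : #|F| = (#|F|.-1./2.*2).+1.
  by case: #|F| hodd q1 => // n /= /negbTE on _; rewrite -[in LHS](odd_double_half n) on.
move: #|F|.-1./2 qE => h qE.
have pw (x : F) : x != 0 -> x ^+ h.*2 = 1.
  move=> x0; apply: (mulfI x0); rewrite mulr1 -exprS -qE; exact: expf_card.
have N1 : (-1 : F) != 0 by rewrite oppr_eq0 oner_neq0.
have hE := odd_double_half h.
case oh : (odd h) in hE.
  suff -> : qchar (-1) = -1 by exists (h./2.+1%:Z); rewrite qE; lia.
  case: (qchar_pm N1) => // /(qcharP N1)[x x0 xE].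
  have := pw x x0; rewrite -mul2n exprM -xE -signr_odd oh expr1 => /eqP.
  by rewrite eq_sym eq_opp0 oner_eq0.
suff -> : qchar (-1) = 1 by exists (h./2%:Z); rewrite qE; lia.
have h0 : (0 < h)%N by rewrite lt0n; apply: contraTneq q1 => h0; rewrite qE h0.
suff [a a0 an] : exists2 a : F, a != 0 & a ^+ h != 1.
  have := pw a a0; rewrite -muln2 exprM => /eqP; rewrite sqrf_eq1 (negPf an) /=.
  by rewrite -hE -muln2 exprM => /eqP <-; rewrite qchar_sq ?expf_neq0.
(* If every nonzero [a] had a^h = 1, the polynomial ['X^h - 1] would have 2h roots. *)
case: (pickP (fun a : F => (a != 0) && (a ^+ h != 1))) => [a /andP[? ?]|no].
  by exists a.
have p0 : 'X^h - 1 != 0 :> {poly F} by rewrite -size_poly_eq0 size_XnsubC.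
have := max_poly_roots p0 (rs := [seq a <- enum F | a != 0]).
rewrite size_XnsubC // filter_uniq ?enum_uniq //= => /(_ _ isT).
have -> : size [seq a <- enum F | a != 0] = h.*2.
  rewrite size_filter -[LHS](addKn (count_mem (0 : F) (enum F))).
  rewrite (count_predC (pred1 (0 : F))) -cardE count_uniq_mem ?enum_uniq // mem_enum.
  by rewrite qE inE subn1.
rewrite ltnS => H; have : (h.*2 <= h)%N; last by lia.
apply: H; apply/allP => a; rewrite mem_filter => /andP[a0 _].
rewrite rootE !hornerE subr_eq0.
by have := no a; rewrite a0 /= => /negbFE.
Qed.

(* Pigeonhole: the values [x^2] and the values [t - b y^2] are more than half
   of F each. *)
Lemma binary_universal (b t : F) : b != 0 -> exists x y, x ^+ 2 + b * y ^+ 2 = t.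
Proof.
move=> b0; pose A := [set x ^+ 2 | x in F]; pose B := [set t - b * a | a in A].
have cB : #|B| = #|A|.
  by rewrite card_imset // => u v /addrI/oppr_inj/(mulfI b0).
have cA : (#|F| < #|A|.*2)%N.
  have e : #|F|%:Z = \sum_(a in A) (1 + qchar a).
    rewrite -[#|F|]sum1_card [in LHS](partition_big (fun x : F => x ^+ 2) (mem A)) /=; last first.
      by move=> x _; apply/imsetP; exists x.
    rewrite Posz_sum; apply: eq_bigr => a _.
    by rewrite -card_sqrt sum1dep_card.
  have A0 : 0 \in A by apply/imsetP; exists 0; rewrite // expr0n.
  have : #|F|%:Z <= 1 + \sum_(a in A | a != 0) 2.
    rewrite e (bigD1 0) //= qchar0 addr0 lerD2l.
    apply: ler_sum => a /andP[_ a0].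
    by case: (qchar_pm a0) => ->.
  rewrite sumr_const; have := cardD1 0 A; rewrite A0.
  have -> : #|[pred i in A | i != 0]| = #|[predD1 A & 0]|.
    by apply: eq_card => i; rewrite !inE andbC.
  rewrite -mulr_natr natz add1n => ->.
  by move: #|_| #|_| => u v; lia.
have : (0 < #|A :&: B|)%N.
  rewrite -(ltn_add2l #|A :|: B|) addn0 cardsUI cB addnn.
  by apply: leq_trans cA; rewrite ltnS max_card.
case/card_gt0P => c; rewrite inE => /andP[/imsetP[x _ ->]].
case/imsetP => _ /imsetP[y _ ->] xy; exists x, y.
by rewrite xy subrK.
Qed.

Lemma card_field_neq0 : #|[pred i : F | i != 0]|%:Z = #|F|%:Z - 1.
Proof.
have -> : #|[pred i : F | i != 0]| = #|F|.-1.
  by rewrite -[in RHS](cardC1 (0 : F)); apply: eq_card => i; rewrite !inE.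
by have := finNzRing_gt1 F; lia.
Qed.

Definition conic_count (b t : F) : int :=
  #|[set p : F * F | p.1 ^+ 2 + b * p.2 ^+ 2 == t]|%:Z.

(* Multiplication by an element of norm [t] identifies the conic of norm 1 with
   that of norm [t]. *)
Lemma conic_count_const b t : b != 0 -> t != 0 -> conic_count b t = conic_count b 1.
Proof.
move=> b0 t0; have [x0 [y0 xy0]] := binary_universal t b0.
pose f (p : F * F) := (p.1 * x0 - b * p.2 * y0, p.1 * y0 + p.2 * x0).
pose g (p : F * F) := ((p.1 * x0 + b * p.2 * y0) / t, (p.2 * x0 - p.1 * y0) / t).
have fK : cancel f g.
  by case=> x y; rewrite /f /g -xy0 /=; congr (_, _); field; rewrite xy0.
have gK : cancel g f.
  by case=> x y; rewrite /f /g -xy0 /=; congr (_, _); field; rewrite xy0.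
rewrite /conic_count; congr Posz; rewrite -[RHS](card_imset _ (can_inj fK)).
apply: eq_card => p; rewrite inE; apply/idP/imsetP => [/eqP pt|[p' + ->]].
  exists (g p); rewrite ?gK // inE /g /=; apply/eqP.
  rewrite (_ : _ + _ = (p.1 ^+ 2 + b * p.2 ^+ 2) * (x0 ^+ 2 + b * y0 ^+ 2) / t ^+ 2).
    by rewrite pt xy0 -expr2 divff // sqrf_eq0.
  by field.
rewrite inE => /eqP p1; apply/eqP.
by rewrite -[RHS]mul1r -p1 -xy0 /f /=; ring.
Qed.

(** Over a fixed nonzero y the equation x^2 = -b y^2 has 1 + [qchar (- b)] solutions, since the
    factor y^2 does not change the character. *)
Lemma conic_count0 b : b != 0 -> conic_count b 0 = 1 + (#|F|%:Z - 1) * (1 + qchar (- b)).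
Proof.
move=> b0; rewrite /conic_count -sum1_card (partition_big (fun p => p.2) predT) //=.
rewrite Posz_sum (bigD1 0) //=; congr (_ + _).
  rewrite sum1dep_card (_ : finset _ = [set (0, 0)]) ?cards1 //.
  apply/setP => -[x y]; rewrite !inE /= xpair_eqE.
  by case: (eqVneq y 0) => [->|]; rewrite ?andbF // expr0n mulr0 addr0 sqrf_eq0.
rewrite (eq_bigr (fun => 1 + qchar (- b))) => [|y y0].
  rewrite big_const iter_addr_0 /= -mulr_natl.
  by rewrite natz card_field_neq0.
rewrite -(qcharMsq (- b) y0) -card_sqrt sum1dep_card.
congr Posz; rewrite -[RHS](card_imset _ (f := fun x => (x, y))); last by move=> u v [].
apply: eq_card => -[x z]; rewrite !inE /=.
apply/andP/imsetP => [[/eqP h /eqP zy]|[x' + [-> ->]]].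
  by rewrite zy in h *; exists x; rewrite // inE -subr_eq0 mulNr opprK h.
by rewrite inE => /eqP ->; rewrite eqxx mulNr addNr.
Qed.

(** All nonzero [t] share one count, which is therefore determined by the count at 0 and the total
    |F|^2. *)
Lemma conic_countE b t : b != 0 ->
  conic_count b t = #|F|%:Z - qchar (- b) + #|F|%:Z * qchar (- b) * (t == 0).
Proof.
move=> b0; have [->|t0] := eqVneq t 0.
  by rewrite conic_count0 //= mulr1; ring.
rewrite mulr0 addr0 conic_count_const //.
have h : \sum_t conic_count b t = #|F|%:Z ^+ 2.
  rewrite expr2 -PoszM -card_prod -sum1_card.
  rewrite [in RHS](partition_big (fun p => p.1 ^+ 2 + b * p.2 ^+ 2) predT) //= Posz_sum.
  by apply: eq_bigr => c _; rewrite /conic_count -sum1dep_card.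
rewrite (bigD1 0) //= conic_count0 // in h.
rewrite (eq_bigr (fun => conic_count b 1)) in h; last first.
  by move=> c c0; rewrite conic_count_const.
have q1 := finNzRing_gt1 F.
rewrite big_const iter_addr_0 /= -mulr_natl natz in h.
rewrite card_field_neq0 in h; have qn0 : #|F|%:Z - 1 != 0 by move: #|F| q1 => *; lia.
apply: (mulfI qn0).
by apply: (addrI (1 + (#|F|%:Z - 1) * (1 + qchar (- b)))); rewrite h; ring.
Qed.

End QuadraticCharacter.

(** * Congruence of symmetric matrices *)

Section Congruence.

Variable F : finFieldType.
Hypothesis hodd : odd #|F|.

Lemma mx11_eq (A B : 'M[F]_1) : A 0 0 = B 0 0 -> A = B.
Proof. by move=> h; rewrite [A]mx11_scalar [B]mx11_scalar h. Qed.

Lemma sym_congr d n (S : 'M[F]_d) (P : 'M_(n, d)) :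
  S^T = S -> (P *m S *m P^T)^T = P *m S *m P^T.
Proof. by move=> sS; rewrite !trmx_mul trmxK sS mulmxA. Qed.

Lemma unitmx_congr n (S P : 'M[F]_n) :
  P \in unitmx -> (P *m S *m P^T \in unitmx) = (S \in unitmx).
Proof. by move=> uP; rewrite !unitmx_mul unitmx_tr uP andbT. Qed.

Lemma qchar_det_congr n (S P : 'M[F]_n) : P \in unitmx ->
  qchar (\det (P *m S *m P^T)) = qchar (\det S).
Proof.
rewrite unitmxE unitfE => uP.
by rewrite !det_mulmx det_tr mulrAC -expr2 mulrC qcharMsq.
Qed.

(** [R'] is a basis of the orthogonal complement of the rows of [R], that is of the kernel of
    [S *m R^T]. Invertibility of [R *m S *m R^T] gives this kernel dimension [s] and makes it
    independent of the rows of [R]. *)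
Lemma ortho_extend r s (S : 'M[F]_(r + s)) (R : 'M_(r, r + s)) :
  S^T = S -> S \in unitmx -> R *m S *m R^T \in unitmx ->
  exists2 R' : 'M_(s, r + s), col_mx R R' \in unitmx &
    col_mx R R' *m S *m (col_mx R R')^T
      = block_mx (R *m S *m R^T) 0 0 (R' *m S *m R'^T).
Proof.
move=> sS uS uM.
have rR : \rank (S *m R^T) = r.
  apply/eqP; rewrite eqn_leq rank_leq_col /=.
  rewrite -[X in (X <= _)%N](mxrank_unit uM) -mulmxA mxrankM_maxr //.
have rK : \rank (kermx (S *m R^T)) = s by rewrite mxrank_ker rR addKn.
have [R' [rR' R'0]] : exists R' : 'M_(s, r + s), \rank R' = s /\ R' *m (S *m R^T) = 0.
  have := eq_row_base (kermx (S *m R^T)); have := row_base_free (kermx (S *m R^T)).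
  move: (row_base _); rewrite rK => R' /eqP fR eR.
  by exists R'; split=> //; apply/sub_kermxP; rewrite eR.
have R'0' : R *m S *m R'^T = 0.
  by apply: trmx_inj; rewrite !trmx_mul sS trmxK trmx0.
have R'0a := R'0; rewrite mulmxA in R'0a.
exists R'; last first.
  by rewrite mul_col_mx tr_col_mx mul_col_row R'0' R'0a.
rewrite -row_free_unit; apply/row_freeP.
suff : row_free (col_mx R R') by move/row_freeP.
apply/inj_row_free => v; rewrite -[v]hsubmxK mul_row_col => h.
have v1 : lsubmx v = 0.
  have := congr1 (mulmx^~ (S *m R^T)) h.
  rewrite mulmxDl mul0mx -!mulmxA R'0 mulmx0 addr0.
  by rewrite -mulmxA in uM => /(canRL (mulmxK uM)); rewrite mul0mx.
move: h; rewrite v1 mul0mx add0r => h.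
suff -> : rsubmx v = 0 by rewrite row_mx0.
apply: (row_free_inj (A := R')); last by rewrite h mul0mx.
by rewrite /row_free rR'.
Qed.

Lemma block_diag_unit r s (M : 'M[F]_r) (M' : 'M_s) :
  (block_mx M 0 0 M' \in unitmx) = (M \in unitmx) && (M' \in unitmx).
Proof. by rewrite unitmxE det_ublock unitrM -!unitmxE. Qed.

(** Polarisation on basis vectors: a form vanishing on every vector would have 2 S_ij = 0 for all i,
    j. *)
Lemma mx_anisotropic n (S : 'M[F]_n) : S^T = S -> S != 0 ->
  exists v : 'rV_n, (v *m S *m v^T) 0 0 != 0.
Proof.
move=> sS S0; apply/existsP; apply: contraNT S0 => /existsPn h.
have q0 (v : 'rV_n) : v *m S *m v^T = 0.
  by apply: mx11_eq; rewrite [RHS]mxE; apply/eqP/negbNE/h.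
apply/eqP/matrixP => i j; rewrite mxE.
have := q0 (delta_mx 0 i + delta_mx 0 j).
rewrite linearD /= mulmxDl mulmxDr !mulmxDl !q0 add0r addr0.
have e a b : delta_mx 0 a *m S *m (delta_mx 0 b)^T = (S a b)%:M :> 'M_1.
  by rewrite -rowE trmx_delta -colE; apply: mx11_eq; rewrite !mxE mulr1n.
rewrite !e -raddfD /= => /(congr1 (fun M : 'M_1 => M 0 0)).
rewrite !mxE mulr1n -{1}sS mxE => /eqP; rewrite -mulr2n -mulr_natl mulf_eq0.
by rewrite (negPf (two_neq0 hodd)) => /eqP.
Qed.

Lemma ortho_extend_vec n (S : 'M[F]_(1 + n)) (v : 'rV_(1 + n)) :
  S^T = S -> S \in unitmx -> (v *m S *m v^T) 0 0 != 0 ->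
  exists2 R' : 'M_(n, 1 + n), col_mx v R' \in unitmx &
    col_mx v R' *m S *m (col_mx v R')^T
      = block_mx (v *m S *m v^T) 0 0 (R' *m S *m R'^T).
Proof.
move=> sS uS v0; apply: ortho_extend => //.
by rewrite [v *m S *m v^T]mx11_scalar unitmxE det_scalar1 unitfE.
Qed.

(** Dimension at least 2 supplies two orthogonal anisotropic vectors; on their plane the form a x^2
    + b y^2 takes every value. *)
Lemma unit_vector n (S : 'M[F]_(2 + n)) : S^T = S -> S \in unitmx ->
  exists v : 'rV_(2 + n), v *m S *m v^T = 1%:M.
Proof.
rewrite -[(2 + n)%N]/(1 + (1 + n))%N => sS uS.
have S0 m (T : 'M[F]_(1 + m)) : T \in unitmx -> T != 0.
  by apply: contraTneq => ->; rewrite unitmxE det0 unitr0.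
have [v v0] := mx_anisotropic sS (S0 _ _ uS).
have [R' uP e] := ortho_extend_vec sS uS v0.
have uB : R' *m S *m R'^T \in unitmx.
  by move: uS; rewrite -(unitmx_congr _ uP) e block_diag_unit => /andP[].
have [w w0] := mx_anisotropic (sym_congr R' sS) (S0 _ _ uB).
set a := (v *m S *m v^T) 0 0 in v0; set b := (w *m _ *m w^T) 0 0 in w0.
(* This is a x^2 + b y^2 = 1 divided by [a], the shape that [binary_universal] handles. *)
have [x [y xy]] : exists x y, x ^+ 2 + (b / a) * y ^+ 2 = a^-1.
  by apply: binary_universal; rewrite // mulf_neq0 ?invr_eq0.
exists (row_mx x%:M (y *: w) *m col_mx v R').
rewrite trmx_mul mulmxA -(mulmxA _ _ S) -(mulmxA _ _ (col_mx v R')^T) e.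
rewrite mul_row_block !mulmx0 addr0 add0r tr_row_mx mul_row_col.
rewrite tr_scalar_mx mul_scalar_mx mul_mx_scalar scalerA linearZ /=.
rewrite -!scalemxAl -scalemxAr scalerA [v *m S *m v^T]mx11_scalar -/a.
rewrite [w *m _ *m w^T]mx11_scalar -/b !scale_scalar_mx -raddfD /=.
by congr (_%:M); rewrite -[RHS](mulfV v0) -xy; field.
Qed.

Lemma det_block_diag r s (M : 'M[F]_r) (M' : 'M_s) :
  \det (block_mx M 0 0 M') = \det M * \det M'.
Proof. exact: det_ublock. Qed.

(** Unit vectors are split off without changing the class of the discriminant; in dimension 1 the
    form is then a nonzero square and can be rescaled to 1. *)
Lemma sq_det_congr1 n (S : 'M[F]_n) : S^T = S -> S \in unitmx ->
  qchar (\det S) = 1 -> exists2 P, P \in unitmx & P *m S *m P^T = 1%:M.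
Proof.
elim: n S => [|n IH]; first by exists 1%:M; rewrite ?unitmx1 //; apply/matrixP => -[].
rewrite -[n.+1]/(1 + n)%N => S sS uS dS.
have [P uP [S' e]] : exists2 P : 'M_(1 + n), P \in unitmx &
    exists S', P *m S *m P^T = block_mx 1%:M 0 0 S'.
  case: n {IH} S sS uS dS => [|n] S sS uS dS.
    move: uS; rewrite unitmxE unitfE => d0; have [x x0 dx] := qcharP d0 dS.
    exists (x^-1)%:M; first by rewrite unitmxE det_scalar1 unitfE invr_eq0.
    exists 1%:M; rewrite -scalar_mx_block [S]mx11_scalar -[S 0 0]det_mx11 dx.
    by rewrite tr_scalar_mx -!scalar_mxM; congr (_%:M); field.
  have [v v1] := unit_vector sS uS.
  have [|R' uP e] := @ortho_extend_vec _ S v sS uS.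
    by rewrite v1 mxE oner_neq0.
  by exists (col_mx v R') => //; exists (R' *m S *m R'^T); rewrite e v1.
have sB : (block_mx 1%:M 0 0 S' : 'M[F]_(1 + n))^T = block_mx 1%:M 0 0 S'.
  by rewrite -e sym_congr.
have sS' : S'^T = S'.
  by move: sB; rewrite tr_block_mx => /eq_block_mx[].
have dB := qchar_det_congr S uP; rewrite e det_block_diag det1 mul1r dS in dB.
have uS' : S' \in unitmx.
  by move: uS; rewrite -(unitmx_congr _ uP) e block_diag_unit => /andP[].
have [P' uP' e'] := IH _ sS' uS' dB.
exists (block_mx 1%:M 0 0 P' *m P).
  by rewrite unitmx_mul uP andbT block_diag_unit unitmx1.
rewrite trmx_mul !mulmxA -(mulmxA _ P) -(mulmxA _ (P *m S)) e tr_block_mx.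
by rewrite !(mulmx_block, mulmx0, mul0mx, addr0, add0r, mul1mx, trmx1, mulmx1,
  trmx0, e') -scalar_mx_block.
Qed.

End Congruence.

(** * Counting orthonormal frames *)

Section Frames.

Variable F : finFieldType.
Hypothesis hodd : odd #|F|.

Definition frames j d (S : 'M[F]_d) : {set 'M[F]_(j, d)} :=
  [set A | A *m S *m A^T == 1%:M].

Lemma framesP j d (S : 'M[F]_d) (A : 'M_(j, d)) :
  reflect (A *m S *m A^T = 1%:M) (A \in frames j S).
Proof. by rewrite inE; apply: eqP. Qed.

Lemma card_frames_congr j d (S P : 'M[F]_d) : P \in unitmx ->
  #|frames j (P *m S *m P^T)| = #|frames j S|.
Proof.
move=> uP; rewrite -(card_imset _ (can_inj (mulmxK uP))).
apply: eq_card => A; apply/imsetP/framesP => [[B /framesP hB ->]|hA].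
  by rewrite trmx_mul !mulmxA in hB *.
exists (A *m invmx P); last by rewrite mulmxKV.
by apply/framesP; rewrite !mulmxA mulmxKV // -(mulmxA _ P^T) -trmx_mul mulmxKV.
Qed.

Lemma unit_vector_split m (S : 'M[F]_(1 + (1 + m))) : S^T = S -> S \in unitmx ->
  exists2 S' : 'M_(1 + m), [/\ S'^T = S', S' \in unitmx & qchar (\det S') = qchar (\det S)] &
  exists2 P, P \in unitmx & P *m S *m P^T = block_mx (1%:M : 'M_1) 0 0 S'.
Proof.
move=> sS uS; have [v v1] := @unit_vector F hodd m S sS uS.
have [|R' uP e] := @ortho_extend_vec F _ S v sS uS.
  by rewrite v1 mxE oner_neq0.
rewrite v1 in e; exists (R' *m S *m R'^T); last by exists (col_mx v R').
split; first exact: sym_congr.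
  by move: uS; rewrite -(unitmx_congr _ uP) e block_diag_unit => /andP[].
by rewrite -(qchar_det_congr hodd _ uP) e det_block_diag det1 mul1r.
Qed.

Lemma quad_row_block r s (M : 'M[F]_r) (M' : 'M_s) j (x : 'M_(j, r)) (y : 'M_(j, s)) :
  row_mx x y *m block_mx M 0 0 M' *m (row_mx x y)^T = x *m M *m x^T + y *m M' *m y^T.
Proof. by rewrite mul_row_block !mulmx0 addr0 add0r tr_row_mx mul_row_col. Qed.

Lemma quad_scalar (a : F) : a%:M *m 1%:M *m (a%:M)^T = (a ^+ 2)%:M :> 'M_1.
Proof. by rewrite mulmx1 tr_scalar_mx -scalar_mxM. Qed.

Lemma eq_scalar11 (a b : F) : (a%:M == b%:M :> 'M_1) = (a == b).
Proof.
apply/eqP/eqP => [/matrixP/(_ 0 0)|-> //].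
by rewrite !mxE eqxx !mulr1n.
Qed.

Let q := #|F|%:Z.
Let eta : int := qchar (-1 : F).

(** The first two coordinates are fibred over the remaining ones: above [y] lies the conic x1^2 +
    x2^2 = 1 - Q(y), whose size depends only on whether Q(y) = 1. *)
Lemma sphere_card_step m (S : 'M[F]_m) :
  #|frames 1 (block_mx (1%:M : 'M_1) 0 0 (block_mx (1%:M : 'M_1) 0 0 S))|%:Z
    = (q - eta) * q ^+ m + q * eta * #|frames 1 S|%:Z.
Proof.
rewrite -sum1_card (partition_big (fun x => rsubmx (rsubmx x)) predT) //=.
rewrite Posz_sum.
transitivity (\sum_(y : 'rV[F]_m) (q - eta + q * eta * (y \in frames 1 S)%:Z)).
  apply: eq_bigr => y _; rewrite sum1dep_card.
  transitivity (conic_count 1 (1 - (y *m S *m y^T) 0 0) : int).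
    rewrite /conic_count; congr Posz.
    pose f (p : F * F) : 'rV_(1 + (1 + m)) := row_mx p.1%:M (row_mx p.2%:M y).
    have If : injective f.
      move=> [a b] [c d] /eq_row_mx[/= e1 /eq_row_mx[e2 _]].
      by congr (_, _); [move/matrixP: e1|move/matrixP: e2] => /(_ 0 0); rewrite !mxE eqxx !mulr1n.
    have fE p : (f p \in frames 1 (block_mx (1%:M : 'M_1) 0 0 (block_mx (1%:M : 'M_1) 0 0 S)))
        = (p.1 ^+ 2 + 1 * p.2 ^+ 2 == 1 - (y *m S *m y^T) 0 0).
      have := mx11_scalar (y *m S *m y^T); set c := _ 0 0 => cE.
      rewrite inE !quad_row_block !quad_scalar cE -!raddfD /= eq_scalar11.
      by rewrite mul1r eq_sym addrA -subr_eq eq_sym.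
    rewrite -(card_imset _ If); apply: eq_card => x; rewrite inE.
    apply/andP/imsetP => [[xf /eqP xy]|[p + ->]].
      exists (lsubmx x 0 0, lsubmx (rsubmx x) 0 0); last first.
        by rewrite /f /= -!mx11_scalar -xy !hsubmxK.
      by rewrite inE -fE /f /= -!mx11_scalar -xy !hsubmxK.
    by rewrite inE -fE => ->; rewrite /f !row_mxKr.
  rewrite conic_countE ?oner_neq0 // -/q -/eta subr_eq0 eq_sym; congr (_ + _ * Posz _).
  rewrite inE; congr nat_of_bool; apply/eqP/eqP => [h|->]; last by rewrite mxE.
  by apply: mx11_eq; rewrite h mxE.
rewrite big_split /= sumr_const -mulr_sumr card_mx mul1n -mulr_natr natrX natz.
congr (_ + _ * _); rewrite -sum1_card Posz_sum [RHS]big_mkcond /=.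
by apply: eq_bigr => y _; case: ifP.
Qed.

Lemma sphere_card1 (S : 'M[F]_1) : S \in unitmx ->
  #|frames 1 S|%:Z = 1 + qchar (\det S).
Proof.
rewrite unitmxE unitfE det_mx11 => s0.
have -> : qchar (S 0 0) = qchar (S 0 0)^-1.
  by rewrite -(qcharMsq hodd (S 0 0) (invr_neq0 s0)) expr2 mulVKf.
rewrite -card_sqrt //; congr Posz.
have Im : injective (fun x : F => x%:M : 'M_1).
  by move=> x y /matrixP/(_ 0 0); rewrite !mxE eqxx !mulr1n.
rewrite -[RHS](card_imset _ Im); apply: eq_card => x; rewrite inE.
move: (mx11_scalar x) (mx11_scalar S) s0; move: (x 0 0) (S 0 0) => z s -> -> s0.
rewrite mem_imset // inE.
rewrite tr_scalar_mx -!scalar_mxM eq_scalar11 mulrAC -expr2.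
by rewrite -[s^-1]mul1r; apply/eqP/eqP => [<-|->]; rewrite ?mulfK ?mulfVK.
Qed.

Lemma sphere_card_rec m (S : 'M[F]_(1 + (1 + (1 + m)))) : S^T = S -> S \in unitmx ->
  exists S' : 'M_(1 + m), [/\ S'^T = S', S' \in unitmx, qchar (\det S') = qchar (\det S) &
    #|frames 1 S|%:Z = (q - eta) * q ^+ m.+1 + q * eta * #|frames 1 S'|%:Z].
Proof.
move=> sS uS.
have [S' [sS' uS' <-] [P uP e]] := unit_vector_split sS uS.
have [S'' [sS'' uS'' dS''] [P' uP' e']] := unit_vector_split sS' uS'.
exists S''; split=> //.
have uB : block_mx (1%:M : 'M_1) 0 0 P' \in unitmx by rewrite block_diag_unit unitmx1.
rewrite -(card_frames_congr 1 S uP) e -(card_frames_congr 1 _ uB).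
rewrite tr_block_mx !mulmx_block.
rewrite !(mulmx0, mul0mx, addr0, add0r, trmx0, trmx1, mul1mx) e'.
exact: sphere_card_step.
Qed.

Lemma sphere_card_odd a (S : 'M[F]_(a.*2.+1)) : S^T = S -> S \in unitmx ->
  #|frames 1 S|%:Z = q ^+ a.*2 + eta ^+ a * qchar (\det S) * q ^+ a.
Proof.
elim: a S => [|a IH]; first by move=> S _ uS; rewrite !expr0 mul1r mulr1 sphere_card1.
rewrite doubleS -[a.*2.+3]/(1 + (1 + (1 + a.*2)))%N => S sS uS.
have [S' [sS' uS' <- ->]] := sphere_card_rec sS uS.
by rewrite (IH S') // !exprS; ring.
Qed.

(** [sphere_card_rec] starts at dimension 3. In dimension 2, splitting off one unit vector leaves
    the conic x^2 + b y^2 = 1, where b has the quadratic character of the discriminant. *)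
Lemma sphere_card_even a (S : 'M[F]_(a.*2.+2)) : S^T = S -> S \in unitmx ->
  #|frames 1 S|%:Z = q ^+ a.*2.+1 - eta ^+ a.+1 * qchar (\det S) * q ^+ a.
Proof.
elim: a S => [|a IH].
  rewrite -[0.*2.+2]/(1 + (1 + 0))%N => S sS uS.
  have [S' [sS' uS' <-] [P uP e]] := unit_vector_split sS uS.
  rewrite -(card_frames_congr 1 S uP) e.
  have d0 : \det S' != 0 by rewrite -unitfE -unitmxE.
  rewrite !expr1 expr0 mulr1 -(qcharM hodd) ?oppr_eq0 ?oner_neq0 // mulN1r.
  transitivity (conic_count (\det S') 1); last first.
    by rewrite conic_countE // oner_eq0 mulr0 addr0.
  rewrite /conic_count; congr Posz.
  pose f (p : F * F) : 'rV_(1 + 1) := row_mx p.1%:M p.2%:M.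
  have If : injective f.
    move=> [a b] [c d] /eq_row_mx[/= e1 e2].
    by congr (_, _); [move/matrixP: e1|move/matrixP: e2] => /(_ 0 0); rewrite !mxE eqxx !mulr1n.
  rewrite -(card_imset _ If); apply: eq_card => x.
  have -> : x = f (lsubmx x 0 0, rsubmx x 0 0) by rewrite /f -!mx11_scalar hsubmxK.
  rewrite mem_imset // !inE /f quad_row_block quad_scalar.
  rewrite det_mx11 {1}[S']mx11_scalar tr_scalar_mx -!scalar_mxM -raddfD eq_scalar11 /=.
  by congr (_ + _ == _); ring.
rewrite doubleS -[a.*2.+4]/(1 + (1 + (1 + a.*2.+1)))%N => S sS uS.
have [S' [sS' uS' <- ->]] := sphere_card_rec sS uS.
by rewrite (IH S') // !exprS; ring.
Qed.

(* The number of unit vectors of a nondegenerate quadratic space of dimension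
   [d > 0] whose discriminant has quadratic character [e]. *)
Definition sphere (d : nat) (e : int) : int :=
  if odd d then q ^+ d.-1 + eta ^+ d./2 * e * q ^+ d./2
  else q ^+ d.-1 - eta ^+ d./2 * e * q ^+ d./2.-1.

Lemma sphere_card d (S : 'M[F]_d) : (0 < d)%N -> S^T = S -> S \in unitmx ->
  #|frames 1 S|%:Z = sphere d (qchar (\det S)).
Proof.
case: d S => // d; rewrite -(odd_double_half d); case: (odd d) => S _ sS uS.
  by rewrite sphere_card_even // /sphere /= odd_double /= doubleK.
by rewrite sphere_card_odd // /sphere /= odd_double /= uphalf_double.
Qed.

(** The vectors after [v] form a frame of its orthogonal complement, whose discriminant has the same
    character because [v] has norm 1. Hence the number of continuations is the same for every
    [v]. *)
Lemma card_frames_rec j d (S : 'M[F]_(1 + d)) : S^T = S -> S \in unitmx ->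
  (forall v : 'rV_(1 + d), v *m S *m v^T = 1%:M -> exists2 S' : 'M_d,
    [/\ S'^T = S', S' \in unitmx & qchar (\det S') = qchar (\det S)] &
    #|[set A in frames (1 + j) S | usubmx A == v]| = #|frames j S'|).
Proof.
move=> sS uS v v1.
have [|R' uP e] := @ortho_extend_vec F _ S v sS uS.
  by rewrite v1 mxE oner_neq0.
rewrite v1 in e; exists (R' *m S *m R'^T).
  split; first exact: sym_congr.
    by move: uS; rewrite -(unitmx_congr _ uP) e block_diag_unit => /andP[].
  by rewrite -(qchar_det_congr hodd _ uP) e det_block_diag det1 mul1r.
pose f (B : 'M[F]_(j, d)) : 'M_(1 + j, 1 + d) := col_mx v (B *m R').
have fR : row_free R'.
  apply: inj_row_free => x xR; move: uP; rewrite -row_free_unit => /row_freeP[X PX].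
  suff : row_mx (0 : 'M_1) x = 0 by rewrite -(row_mx0 F 1 1 d) => /eq_row_mx[].
  by rewrite -[LHS]mulmx1 -PX mulmxA mul_row_col mul0mx xR addr0 mul0mx.
have If : injective f by move=> A B /eq_col_mx[_ /(row_free_inj fR)].
rewrite -(card_imset _ If); apply: eq_card => A; rewrite inE.
move: e; rewrite mul_col_mx tr_col_mx mul_col_row => /eq_block_mx[_ v0 R'0 _].
apply/andP/imsetP => [[/framesP AS /eqP Av]|[B /framesP BS ->]]; last first.
  rewrite /f col_mxKu; split=> //; apply/framesP.
  rewrite mul_col_mx tr_col_mx mul_col_row v1 trmx_mul -!mulmxA.
  rewrite (mulmxA v) (mulmxA (v *m S)) v0 (mulmxA R') R'0 !mulmxA.
  by rewrite !mulmxA in BS; rewrite BS mulmx0 mul0mx -scalar_mx_block.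
move: AS; rewrite -[A]vsubmxK Av; set B := dsubmx A.
rewrite mul_col_mx tr_col_mx mul_col_row (scalar_mx_block 1 j) => /eq_block_mx[_ vB Bv BB].
set P := col_mx v R' in uP; pose C := B *m invmx P.
have BE : B = lsubmx C *m v + rsubmx C *m R'.
  by rewrite -mul_row_col hsubmxK mulmxKV.
(* The rows of [B] are orthogonal to [v], so they have no component along it. *)
have l0 : lsubmx C = 0.
  by move: Bv; rewrite BE mulmxDl mulmxDl -!mulmxA (mulmxA v) v1 (mulmxA R') R'0 mulmx1 mulmx0 addr0.
rewrite l0 mul0mx add0r in BE.
exists (rsubmx C); last by rewrite /f -BE.
by apply/framesP; rewrite !mulmxA -BE -(mulmxA _ R'^T) -trmx_mul -BE BB.
Qed.

Lemma card_frames j d (S : 'M[F]_d) : (j <= d)%N -> S^T = S -> S \in unitmx ->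
  #|frames j S|%:Z = \prod_(i < j) sphere (d - i) (qchar (\det S)).
Proof.
elim: j d S => [|j IH] d S jd sS uS.
  rewrite big_ord0 (_ : frames 0 S = [set 0]) ?cards1 //.
  apply/setP => A; rewrite !inE [A]flatmx0 [RHS]eqxx; apply/eqP.
  by apply/matrixP => -[].
case: d S jd sS uS => // d; rewrite ltnS -[d.+1]/(1 + d)%N => S jd sS uS.
rewrite big_ord_recl subn0 -sphere_card // -sum1_card.
rewrite -[j.+1]/(1 + j)%N (partition_big usubmx (mem (frames 1 S))) /=; last first.
  move=> A /framesP; rewrite -[A]vsubmxK mul_col_mx tr_col_mx mul_col_row.
  rewrite (scalar_mx_block 1 j) => /eq_block_mx[h _ _ _].
  by apply/framesP; rewrite col_mxKu.
rewrite Posz_sum (eq_bigr (fun=> \prod_(i < j) sphere (d - i) (qchar (\det S)))).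
  by rewrite sumr_const -mulr_natl natz.
move=> v /framesP v1; rewrite sum1dep_card.
have [S' [sS' uS' <-] ->] := card_frames_rec j sS uS v1.
exact: IH.
Qed.

End Frames.

(** * Involutive isometries *)

Section Involutions.

Variable F : finFieldType.
Hypothesis hodd : odd #|F|.

Definition isometry d (S : 'M[F]_d) : pred 'M[F]_d := fun G => G *m S *m G^T == S.

Lemma isometryP d (S G : 'M[F]_d) : reflect (G *m S *m G^T = S) (isometry S G).
Proof. exact: eqP. Qed.

(** Vectors are rows: [B] is a map written in the basis formed by the rows of [P], and the conjugate
    is the same map in the standard basis. *)
Lemma isometry_conj d (S P B : 'M[F]_d) : P \in unitmx ->
  isometry (P *m S *m P^T) B -> isometry S (invmx P *m B *m P).
Proof.
move=> uP /isometryP hB; apply/isometryP.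
have uPT : P^T \in unitmx by rewrite unitmx_tr.
have Pu : P *m (invmx P *m B *m P) = B *m P by rewrite -mulmxA mulKVmx.
move: (invmx P *m B *m P) Pu => u Pu.
apply: (can_inj (mulKmx uP)); apply: (can_inj (mulmxK uPT)).
by rewrite !mulmxA -(mulmxA _ u^T) -trmx_mul Pu trmx_mul -[RHS]hB !mulmxA.
Qed.

Lemma det_conj d (P B : 'M[F]_d) : P \in unitmx ->
  \det (invmx P *m B *m P) = \det B.
Proof.
rewrite unitmxE => uP; rewrite !det_mulmx mulrC mulrA det_inv divrr ?mul1r //.
Qed.

Lemma isometry_block r s (M G : 'M[F]_r) (M' G' : 'M[F]_s) :
  isometry M G -> isometry M' G' -> isometry (block_mx M 0 0 M') (block_mx G 0 0 G').
Proof.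
move=> /isometryP h /isometryP h'; apply/isometryP; rewrite tr_block_mx !mulmx_block.
by rewrite !(mulmx0, mul0mx, addr0, add0r, trmx0) h h'.
Qed.

Lemma isometryN1 d (S : 'M[F]_d) : isometry S (- 1%:M).
Proof. by apply/isometryP; rewrite linearN /= trmx1 mulmxN mulNmx mulmx1 mul1mx opprK. Qed.

Lemma isometry1 d (S : 'M[F]_d) : isometry S 1%:M.
Proof. by apply/isometryP; rewrite trmx1 mulmx1 mul1mx. Qed.

Lemma exists_reflection s (M : 'M[F]_(1 + s)) : M^T = M -> M \in unitmx ->
  exists2 u, isometry M u & \det u = -1.
Proof.
move=> sM uM; have [|v v0] := mx_anisotropic hodd sM.
  by apply: contraTneq uM => ->; rewrite unitmxE det0 unitr0.
have [R' uP e] := ortho_extend_vec sM uM v0.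
exists (invmx (col_mx v R') *m block_mx (- 1%:M : 'M_1) 0 0 1%:M *m col_mx v R').
  by apply: isometry_conj => //; rewrite e isometry_block ?isometryN1 ?isometry1.
by rewrite det_conj // det_block_diag det1 mulr1 det_mx11 !mxE eqxx.
Qed.

(** Since (1 - G) G = -(1 - G), the rows of 1 - G span the (-1)-eigenspace. It is nondegenerate
    because S (1 - G)^T = (1 - G) S: a vector w of it that is orthogonal to all of it satisfies 0 =
    w S (1 - G)^T = 2 w S. The same identity shows that [G] fixes the orthogonal complement. *)
Lemma invol_split r s (S G : 'M[F]_(r + s)) : S^T = S -> S \in unitmx ->
  isometry S G -> G *m G = 1%:M -> \rank (1%:M - G) = r ->
  exists R : 'M_(r, r + s), exists R' : 'M_(s, r + s),
    [/\ col_mx R R' \in unitmx,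
     col_mx R R' *m S *m (col_mx R R')^T
       = block_mx (R *m S *m R^T) 0 0 (R' *m S *m R'^T),
     R *m G = - R & R' *m G = R'].
Proof.
move=> sS uS /isometryP GS GG rG.
have := eq_row_base (1%:M - G); have := row_base_free (1%:M - G).
move: (row_base _); rewrite rG => R fR eR.
have /submxP[X RX] : (R <= 1%:M - G)%MS by rewrite eR.
have /submxP[C GC] : (1%:M - G <= R)%MS by rewrite eR.
have RG : R *m G = - R.
  by rewrite RX -mulmxA mulmxBl mul1mx GG -opprB mulmxN.
have SG : S *m G^T = G *m S by rewrite -[in RHS]GS -mulmxA mulmxA GG mul1mx.
have S1G : S *m (1%:M - G)^T = (1%:M - G) *m S.
  by rewrite linearB /= trmx1 mulmxBl mulmxBr SG mul1mx mulmx1.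
have uM : R *m S *m R^T \in unitmx.
  rewrite -row_free_unit; apply: inj_row_free => x xM.
  apply: (row_free_inj fR); rewrite mul0mx; apply: (can_inj (mulmxK uS)); rewrite mul0mx.
  have /eqP : x *m (R *m S *m R^T) *m C^T = 0 by rewrite xM mul0mx.
  rewrite -!mulmxA -trmx_mul -GC S1G (mulmxA R) mulmxBr mulmx1 RG opprK.
  rewrite mulmxDl mulmxDr -mulr2n -scaler_nat scaler_eq0 (negPf (two_neq0 hodd)) /=.
  by rewrite mulmxA => /eqP.
have [R' uP e] := ortho_extend sS uS uM.
exists R, R'; split=> //.
move: e; rewrite mul_col_mx tr_col_mx mul_col_row => /eq_block_mx[_ _ R'0 _].
apply/eqP; rewrite eq_sym -subr_eq0 -{1}[R']mulmx1 -mulmxBr; apply/eqP.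
apply: (can_inj (mulmxK uS)); rewrite mul0mx -mulmxA -S1G GC trmx_mul !mulmxA R'0.
by rewrite mul0mx.
Qed.

Lemma invol_conj r s (P G : 'M[F]_(r + s)) (R : 'M_(r, r + s)) (R' : 'M_(s, r + s)) :
  col_mx R R' \in unitmx -> R *m G = - R -> R' *m G = R' ->
  G = invmx (col_mx R R') *m block_mx (- 1%:M) 0 0 1%:M *m col_mx R R'.
Proof.
move=> uP RG R'G; apply: (can_inj (mulKmx uP)).
rewrite -mulmxA mulKVmx // mul_col_mx RG R'G mul_block_col !mul0mx mulNmx !mul1mx.
by rewrite addr0 add0r.
Qed.

Lemma det_invol r s (G : 'M[F]_(r + s)) (R : 'M_(r, r + s)) (R' : 'M_(s, r + s)) :
  col_mx R R' \in unitmx -> R *m G = - R -> R' *m G = R' -> \det G = (-1) ^+ r.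
Proof.
move=> uP RG R'G; rewrite (invol_conj G uP RG R'G) det_conj //.
by rewrite det_block_diag det1 mulr1 -scaleN1r detZ det1 mulr1.
Qed.

(* The isometry acting as [-1] on the span of the orthonormal rows of [A] and
   trivially on the orthogonal complement. *)
Definition frame_invol r d (S : 'M[F]_d) (A : 'M[F]_(r, d)) : 'M[F]_d :=
  1%:M - 2 *: (S *m A^T *m A).

Lemma frame_involE r d (S : 'M[F]_d) (A : 'M_(r, d)) : A \in frames r S ->
  A *m frame_invol S A = - A.
Proof.
move=> /framesP AS; rewrite /frame_invol mulmxBr mulmx1 -scalemxAr !mulmxA AS mul1mx.
by rewrite scaler_nat mulr2n opprD addrA subrr add0r.
Qed.

Lemma frame_invol_fix r s d (S : 'M[F]_d) (A : 'M_(r, d)) (B : 'M_(s, d)) :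
  B *m S *m A^T = 0 -> B *m frame_invol S A = B.
Proof.
by move=> h; rewrite /frame_invol mulmxBr mulmx1 -scalemxAr !mulmxA h mul0mx scaler0 subr0.
Qed.

Lemma frame_invol_sqr r d (S : 'M[F]_d) (A : 'M_(r, d)) :
  A \in frames r S -> frame_invol S A *m frame_invol S A = 1%:M.
Proof.
move=> hA; rewrite [X in X *m _]/frame_invol mulmxBl mul1mx -scalemxAl -(mulmxA _ A).
by rewrite frame_involE // mulmxN scalerN opprK /frame_invol subrK.
Qed.

Lemma frames_free r d (S : 'M[F]_d) (A : 'M_(r, d)) : A \in frames r S -> row_free A.
Proof.
move=> /framesP AS; apply: inj_row_free => x xA.
by rewrite -[x]mulmx1 -AS !mulmxA xA !mul0mx.
Qed.

Lemma rank_frame_invol r d (S : 'M[F]_d) (A : 'M_(r, d)) : A \in frames r S ->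
  \rank (1%:M - frame_invol S A) = r.
Proof.
move=> hA; have := frames_free hA; rewrite /row_free => /eqP rA.
rewrite /frame_invol opprB addrC subrK mxrank_scale_nz ?two_neq0 //.
apply/eqP; rewrite eqn_leq (leq_trans (mxrankM_maxr _ _) (rank_leq_row _)) /=.
have AE : A = A *m (S *m A^T *m A) by move/framesP: hA; rewrite !mulmxA => ->; rewrite mul1mx.
by apply: leq_trans (mxrankM_maxr A _); rewrite -AE rA.
Qed.

(** Two frames give the same involution exactly when they differ by an orthogonal matrix, and such
    matrices act freely because the rows of a frame are independent. So every fibre of
    [frame_invol S] has the size of the orthogonal group of the standard form, here written as
    [frames r 1%:M]. *)
Lemma card_frame_invols r d (S : 'M[F]_d) : S^T = S -> S \in unitmx ->
  (#|[set frame_invol S A | A in frames r S]| * #|frames r (1%:M : 'M[F]_r)|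
    = #|frames r S|)%N.
Proof.
move=> sS uS; rewrite -[RHS]sum1_card.
rewrite (partition_big (frame_invol S) (mem [set frame_invol S A | A in frames r S])) /=.
  rewrite -sum_nat_const; apply: eq_bigr => _ /imsetP[A hA ->].
  rewrite sum1dep_card; have /row_free_inj IA := frames_free hA.
  rewrite -(card_imset _ (IA r)); apply: eq_card => B; rewrite inE.
  have /framesP AS := hA.
  apply/imsetP/andP => [[U /framesP UU ->]|[hB /eqP e]].
    rewrite mulmx1 in UU; split.
      by apply/framesP; rewrite trmx_mul !mulmxA -(mulmxA U) -(mulmxA U) AS mulmx1.
    have UU' : U^T *m U = 1%:M by apply: mulmx1C.
    by rewrite /frame_invol trmx_mul !mulmxA -(mulmxA _ U^T) UU' mulmx1.
  have e' : B^T *m B = A^T *m A.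
    move: e; rewrite /frame_invol => /addrI/oppr_inj.
    move=> /(congr1 (fun X => 2^-1 *: X)); rewrite !scalerA mulVf ?two_neq0 // !scale1r.
    by rewrite -!mulmxA => /(can_inj (mulKmx uS)).
  have /framesP BS := hB.
  have BE : B = B *m S *m A^T *m A.
    by rewrite -[LHS]mul1mx -BS -!mulmxA e'.
  exists (B *m S *m A^T) => //; apply/framesP.
  by rewrite mulmx1 !trmx_mul trmxK sS !mulmxA -BE BS.
by move=> A hA; apply/imsetP; exists A.
Qed.

(** A square discriminant allows the basis [R] of the (-1)-eigenspace to be replaced by an
    orthonormal one. *)
Lemma invol_frame r s (S G : 'M[F]_(r + s)) (R : 'M_(r, r + s)) (R' : 'M_(s, r + s)) :
  S^T = S -> S \in unitmx -> col_mx R R' \in unitmx ->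
  col_mx R R' *m S *m (col_mx R R')^T
    = block_mx (R *m S *m R^T) 0 0 (R' *m S *m R'^T) ->
  R *m G = - R -> R' *m G = R' -> qchar (\det (R *m S *m R^T)) = 1 ->
  exists2 A, A \in frames r S & G = frame_invol S A.
Proof.
move=> sS uS uP e RG R'G dM.
have uM : R *m S *m R^T \in unitmx.
  by move: uS; rewrite -(unitmx_congr _ uP) e block_diag_unit => /andP[].
have [P0 uP0 e0] := sq_det_congr1 hodd (sym_congr R sS) uM dM.
have hA : P0 *m R \in frames r S.
  by apply/framesP; rewrite -e0 trmx_mul !mulmxA.
exists (P0 *m R) => //; apply: (can_inj (mulKmx uP)).
rewrite !mul_col_mx RG R'G; congr col_mx.
  by apply: (can_inj (mulKmx uP0)); rewrite mulmxA frame_involE // mulmxN.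
move: e; rewrite mul_col_mx tr_col_mx mul_col_row => /eq_block_mx[_ _ R'0 _].
by rewrite frame_invol_fix // trmx_mul mulmxA R'0 mul0mx.
Qed.

(* [-1] is a commutator of isometries of determinant 1 of the span of an even
   orthonormal family: it is the square of a quarter turn [j] that is inverted
   by [a]; a reflection of the complement corrects the determinant of [a]. *)
Lemma frame_invol_comm k s (S : 'M[F]_(k + k + s.+1)) (A : 'M_(k + k, k + k + s.+1)) :
  S^T = S -> S \in unitmx -> A \in frames (k + k) S ->
  exists a, exists j, [/\ isometry S a, isometry S j, \det a = 1, \det j = 1 &
    a *m j = frame_invol S A *m j *m a].
Proof.
move=> sS uS hA; have /framesP AS := hA.
have [|R' uP e] := ortho_extend (R := A) sS uS; first by rewrite AS unitmx1.
rewrite AS in e.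
have [sM' uM'] : (R' *m S *m R'^T)^T = R' *m S *m R'^T /\ R' *m S *m R'^T \in unitmx.
  split; first exact: sym_congr.
  by move: uS; rewrite -(unitmx_congr _ uP) e block_diag_unit => /andP[].
have [u iu du] := @exists_reflection s _ sM' uM'.
(* [a0] below has determinant (-1)^k, so the reflection is inserted exactly for odd [k]. *)
pose a1 := if odd k then u else 1%:M.
have ia1 : isometry (R' *m S *m R'^T) a1 by rewrite /a1; case: odd; rewrite ?isometry1.
have da1 : \det a1 = (-1) ^+ k.
  by rewrite /a1 -signr_odd; case: odd; rewrite ?det1 ?expr0.
pose a0 : 'M[F]_(k + k) := block_mx (1%:M) 0 0 (- 1%:M).
pose j0 : 'M[F]_(k + k) := block_mx 0 1%:M (- 1%:M) 0.
have ia0 : isometry (1%:M) a0.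
  by rewrite (scalar_mx_block k k) isometry_block ?isometryN1 ?isometry1.
have ij0 : isometry (1%:M) j0.
  apply/isometryP; rewrite mulmx1 /j0 tr_block_mx mulmx_block (scalar_mx_block k k).
  by rewrite !(mulmx0, mul0mx, addr0, add0r, trmx0, trmx1, mulmx1, mul1mx)
     linearN /= trmx1 mulmxN mulNmx mulmx1 opprK.
have da0 : \det a0 = (-1) ^+ k.
  by rewrite det_block_diag det1 mul1r -scaleN1r detZ det1 mulr1.
have dj0 : \det j0 = 1.
  (* The quarter turn is a product of three shears, each of determinant 1. *)
  pose t1 : 'M[F]_(k + k) := block_mx 1%:M 1%:M 0 1%:M.
  pose t2 : 'M[F]_(k + k) := block_mx 1%:M 0 (- 1%:M) 1%:M.
  have -> : j0 = t1 *m t2 *m t1.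
    by rewrite !mulmx_block !(mulmx0, mul0mx, addr0, add0r, mulmx1, mul1mx, subrr, addNr).
  by rewrite !det_mulmx det_ublock det_lblock !det1 !mulr1.
have a0j0 : a0 *m j0 = - j0 *m a0.
  rewrite mulNmx /a0 /j0 !mulmx_block.
  rewrite !(mulmx0, mul0mx, addr0, add0r, mulNmx, mulmxN, mulmx1, mul1mx).
  by rewrite opp_block_mx !oppr0 !opprK.
move: a0 j0 ia0 ij0 da0 dj0 a0j0 => a0 j0 ia0 ij0 da0 dj0 a0j0.
set P := col_mx A R' in uP e.
have fE : frame_invol S A = invmx P *m block_mx (- 1%:M) 0 0 1%:M *m P.
  apply: (invol_conj S uP); first exact: frame_involE.
  apply: frame_invol_fix.
  by move: e; rewrite mul_col_mx tr_col_mx mul_col_row => /eq_block_mx[_ _ ->].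
exists (invmx P *m block_mx a0 0 0 a1 *m P), (invmx P *m block_mx j0 0 0 1%:M *m P).
split.
- by apply: isometry_conj => //; rewrite e isometry_block.
- by apply: isometry_conj => //; rewrite e isometry_block ?isometry1.
- by rewrite det_conj // det_block_diag da0 da1 -exprMn mulrNN mulr1 expr1n.
- by rewrite det_conj // det_block_diag dj0 det1 mulr1.
rewrite fE -!mulmxA; congr (_ *m _).
do 2!rewrite (mulmxA P (invmx P)) mulmxV // mul1mx.
rewrite !(mulmxA P (invmx P)) mulmxV // !mul1mx !mulmxA; congr (_ *m _).
rewrite !mulmx_block !(mulmx0, mul0mx, addr0, add0r, mulmx1, mul1mx) a0j0.
by rewrite !mulNmx mul1mx.
Qed.

End Involutions.

(** * The sign of an isometry on the unit sphere *)

(** An involution is a product of disjoint transpositions, one for each pair of moved points; the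
    induction peels off the one exchanging [x] and [s x]. *)
Lemma odd_perm_invol (T : finType) (s : {perm T}) : involutive s ->
  odd_perm s = odd #|[set x | s x != x]|./2.
Proof.
have [n] := ubnP #|[set x | s x != x]|; elim: n s => // n IH s; rewrite ltnS => sn sI.
case: (set_0Vmem [set x | s x != x]) => [s0|[x]].
  rewrite s0 cards0 (_ : s = 1%g) ?odd_perm1 //; apply/permP => x; rewrite perm1.
  by apply/eqP/negPn; move/setP/(_ x): s0; rewrite !inE => ->.
rewrite inE => sx; pose t := (tperm x (s x) * s)%g.
have tE y : t y = if (y == x) || (y == s x) then y else s y.
  rewrite permM; case: tpermP => [->|->|/eqP yx /eqP ysx]; rewrite ?eqxx ?orbT ?sI //.
  by rewrite (negPf yx) (negPf ysx).
have tI : involutive t.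
  move=> y; case h: ((y == x) || (y == s x)).
    by have ty : t y = y; rewrite ?tE ?h // ty ty.
  have -> : t y = s y by rewrite tE h.
  rewrite tE sI; case: ifP => // /orP[/eqP e|/eqP/perm_inj e]; last by rewrite e eqxx in h.
  by rewrite -e sI eqxx orbT in h.
have mE : [set y | t y != y] = [set y | s y != y] :\ x :\ s x.
  apply/setP => y; rewrite !inE tE; case: (y =P x) => [->|_]; rewrite ?eqxx ?andbF //=.
  by case: (y =P s x) => [->|_]; rewrite ?eqxx.
have cE : #|[set y | s y != y]| = #|[set y | t y != y]|.+2.
  rewrite mE (cardsD1 x) inE sx (cardsD1 (s x) ([set y | s y != y] :\ x)) !inE sx sI.
  by rewrite eq_sym sx.
have := IH t; rewrite odd_permM odd_tperm eq_sym sx /=.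
rewrite cE /= => <- //; first by rewrite negbK.
by apply: leq_trans sn; rewrite cE.
Qed.

Section SphereSign.

Variable F : finFieldType.

Variables (d : nat) (S : 'M[F]_d).

Definition sphere_map (G : 'M[F]_d) (x : 'rV[F]_d) : 'rV[F]_d :=
  if x \in frames 1 S then x *m G else x.

(** The sphere is extended by fixed points to the whole space, which leaves the sign unchanged and
    avoids a subtype. The default value, the identity, is taken when [sphere_map G] is not
    injective; this does not occur for an isometry of a nondegenerate form. *)
Definition sphere_perm (G : 'M[F]_d) : {perm 'rV[F]_d} :=
  insubd (1%g : {perm 'rV[F]_d}) [ffun x => sphere_map G x].

Lemma frames_isometry j (G : 'M[F]_d) (A : 'M_(j, d)) : isometry S G ->
  (A *m G \in frames j S) = (A \in frames j S).
Proof. by move=> /isometryP GS; rewrite !inE trmx_mul !mulmxA -!(mulmxA A) GS. Qed.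

Lemma isometryM (G H : 'M[F]_d) : isometry S G -> isometry S H -> isometry S (G *m H).
Proof.
move=> /isometryP GS /isometryP HS; apply/isometryP.
have -> : G *m H *m S *m (G *m H)^T = G *m (H *m S *m H^T) *m G^T.
  by rewrite trmx_mul !mulmxA.
by rewrite HS GS.
Qed.

Lemma isometry_unit (G : 'M[F]_d) : S \in unitmx -> isometry S G -> G \in unitmx.
Proof.
move=> uS /isometryP GS; rewrite -row_free_unit; apply: inj_row_free => x xG.
apply: (can_inj (mulmxK uS)); rewrite mul0mx.
by rewrite -GS !mulmxA xG !mul0mx.
Qed.

Lemma sphere_permE (G : 'M[F]_d) x : S \in unitmx -> isometry S G ->
  sphere_perm G x = sphere_map G x.
Proof.
move=> uS iG; rewrite /sphere_perm -pvalE val_insubd; case: ifP => [_|/negP[]].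
  by rewrite ffunE.
have uG := isometry_unit uS iG.
apply/injectiveP => y z; rewrite !ffunE /sphere_map.
case: ifP => hy; case: ifP => hz //.
- exact: (can_inj (mulmxK uG)).
- by move=> e; rewrite -e frames_isometry ?hy in hz.
by move=> e; rewrite e frames_isometry ?hz in hy.
Qed.

Lemma sphere_permM (G H : 'M[F]_d) : S \in unitmx -> isometry S G -> isometry S H ->
  sphere_perm (G *m H) = (sphere_perm G * sphere_perm H)%g.
Proof.
move=> uS iG iH; apply/permP => x; rewrite permM !sphere_permE ?isometryM //.
rewrite /sphere_map; case hx: (x \in frames 1 S); last by rewrite hx.
by rewrite frames_isometry // hx mulmxA.
Qed.

End SphereSign.

Section SphereSignInvolution.

Variable F : finFieldType.
Hypothesis hodd : odd #|F|.

(** Modulo 4 the field size is the sign eta = [qchar (-1)], so in even dimension the two terms of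
    [sphere] reduce to odd powers of eta, the second one times e. The residue is thus independent of
    [d]. *)
Lemma sphere_even_mod4 d (e : int) : (0 < d)%N -> ~~ odd d -> e = 1 \/ e = -1 ->
  exists t, sphere F d e = qchar (-1 : F) * (1 - e) + 4 * t.
Proof.
move=> d0 de he; rewrite /sphere (negPf de).
have [a ->] : exists a, d = a.*2.+2.
  have := odd_double_half d; rewrite (negPf de) add0n => dE; exists d./2.-1.
  by rewrite -doubleS prednK // lt0n; apply: contraTneq d0 => h; rewrite -dE h.
rewrite /= doubleK.
have [t qt] := qcharN1_mod4 hodd.
have eta2 : qchar (-1 : F) ^+ 2 = 1.
  by case: (@qchar_pm F (-1)) => [|->|->] //; rewrite oppr_eq0 oner_neq0.
move: (qchar (-1 : F)) qt eta2 => eta qt eta2.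
have pw n : exists w, #|F|%:Z ^+ n = eta ^+ n + 4 * w.
  elim: n => [|n [w wE]]; first by exists 0.
  by exists (w * eta + 4 * w * t + eta ^+ n * t); rewrite exprS wE qt exprS; ring.
have [w1 ->] := pw a.*2.+1; have [w2 ->] := pw a.
exists (w1 - eta ^+ a.+1 * e * w2).
have -> : eta ^+ a.*2.+1 = eta by rewrite exprS -mul2n exprM eta2 expr1n mulr1.
have -> : eta ^+ a.+1 * e * (eta ^+ a + 4 * w2) =
  (eta ^+ 2) ^+ a * eta * e + 4 * (eta ^+ a.+1 * e * w2).
  by rewrite -exprM mul2n -addnn exprD exprS; ring.
by rewrite eta2 expr1n; ring.
Qed.

(** The fixed points on the sphere are the unit vectors in the span of [R'], so the number of moved
    points is a difference of two spheres of even dimension. With c, c' the characters of the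
    discriminants of [M], [M'], it is congruent to eta c' (1 - c) modulo 4. For c = -1 this is 2
    modulo 4, that is, an odd number of transpositions. *)
Lemma odd_sphere_perm_invol r s (S G : 'M[F]_(r + s))
    (R : 'M_(r, r + s)) (R' : 'M_(s, r + s)) :
  (0 < r + s)%N -> (0 < s)%N -> ~~ odd r -> ~~ odd s ->
  S^T = S -> S \in unitmx -> isometry S G ->
  col_mx R R' \in unitmx ->
  col_mx R R' *m S *m (col_mx R R')^T
    = block_mx (R *m S *m R^T) 0 0 (R' *m S *m R'^T) ->
  R *m G = - R -> R' *m G = R' ->
  ~~ odd_perm (sphere_perm S G) -> qchar (\det (R *m S *m R^T)) = 1.
Proof.
move=> d0 s0 re se sS uS iG uP e RG R'G.
set M := R *m S *m R^T in e *; set M' := R' *m S *m R'^T in e.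
have /andP[uM uM'] : (M \in unitmx) && (M' \in unitmx).
  by rewrite -block_diag_unit -e unitmx_congr.
have [dM dM'] : \det M != 0 /\ \det M' != 0 by rewrite -!unitfE -!unitmxE.
have dS : qchar (\det S) = qchar (\det M) * qchar (\det M').
  by rewrite -(qchar_det_congr hodd S uP) e det_block_diag qcharM.
have sM' : M'^T = M' by exact: sym_congr.
have GE := invol_conj G uP RG R'G.
have GG : G *m G = 1%:M.
  rewrite GE -!mulmxA (mulmxA (col_mx R R') (invmx _)) mulmxV // mul1mx.
  rewrite (mulmxA (block_mx _ _ _ _)) mulmx_block.
  rewrite !(mulmx0, mul0mx, addr0, add0r, mulmxN, mulNmx, mulmx1, mul1mx, opprK).
  by rewrite -scalar_mx_block mul1mx mulVmx.
have fixE : [set x in frames 1 S | x *m G == x] = [set y *m R' | y in frames 1 M'].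
  apply/setP => x; rewrite inE.
  have xE : x = lsubmx (x *m invmx (col_mx R R')) *m R + rsubmx (x *m invmx (col_mx R R')) *m R'.
    by rewrite -mul_row_col hsubmxK mulmxKV.
  apply/andP/imsetP => [[/framesP xS /eqP xG]|[y /framesP yM ->]].
    have l0 : lsubmx (x *m invmx (col_mx R R')) = 0.
      have : x *m G *m invmx (col_mx R R') = x *m invmx (col_mx R R') by rewrite xG.
      rewrite {1}GE -[x in LHS](mulmxKV uP) !mulmxA mulmxK // mulmxK //.
      rewrite -[x *m invmx _]hsubmxK mul_row_block !(mulmx0, addr0, add0r, mulmx1, mulmxN).
      move=> /eq_row_mx[/eqP + _]; rewrite -subr_eq0 -opprD oppr_eq0 -mulr2n -scaler_nat.
      by rewrite scaler_eq0 (negPf (two_neq0 hodd)) row_mxKl => /eqP.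
    rewrite l0 mul0mx add0r in xE.
    exists (rsubmx (x *m invmx (col_mx R R'))) => //; apply/framesP.
    by rewrite /M' !mulmxA -xE -(mulmxA _ R'^T) -trmx_mul -xE.
  split; last by rewrite -mulmxA R'G.
  by apply/framesP; rewrite trmx_mul -yM /M' !mulmxA.
have cfix : #|[set x in frames 1 S | x *m G == x]| = #|frames 1 M'|.
  rewrite fixE card_imset //; apply: row_free_inj.
  apply: inj_row_free => x xR; move: uP; rewrite -row_free_unit => /row_freeP[X PX].
  suff : row_mx (0 : 'M_(1, r)) x = 0 by rewrite -(row_mx0 F 1 r s) => /eq_row_mx[].
  by rewrite -[LHS]mulmx1 -PX mulmxA mul_row_col mul0mx xR addr0 mul0mx.
rewrite odd_perm_invol; last first.
  move=> x; rewrite !sphere_permE // /sphere_map.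
  case hx: (x \in frames 1 S); last by rewrite hx.
  by rewrite frames_isometry // hx -mulmxA GG mulmx1.
have mv : [set x | sphere_perm S G x != x] = frames 1 S :\: [set x in frames 1 S | x *m G == x].
  apply/setP => x; rewrite in_setD !in_set sphere_permE // /sphere_map inE.
  by case: ifP; rewrite ?eqxx // andbT.
have cE : (#|[set x | sphere_perm S G x != x]| + #|frames 1 M'| = #|frames 1 S|)%N.
  rewrite mv -cfix addnC; set A := frames 1 S; set B := [set x in _ | _].
  rewrite -(cardsID B A) (setIidPr _) //; apply/subsetP => x.
  by rewrite inE => /andP[].
have c1 := sphere_card hodd d0 sS uS; have c2 := sphere_card hodd s0 sM' uM'.
move: (#|[set x | _]|) cE => m; move: #|_| #|_| c1 c2 => u v c1 c2 cE om.
case: (qchar_pm dM) => // dM1; exfalso.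
have [|//||t1 e1] := @sphere_even_mod4 (r + s) (qchar (\det S)); rewrite ?oddD ?(negPf re) //.
  by rewrite dS dM1; case: (qchar_pm dM') => ->; auto.
have [|//||t2 e2] := @sphere_even_mod4 s (qchar (\det M')) => //.
  exact: qchar_pm.
rewrite e1 in c1; rewrite e2 in c2; rewrite dS dM1 in c1.
have eta : qchar (-1 : F) = 1 \/ qchar (-1 : F) = -1.
  by apply: qchar_pm; rewrite oppr_eq0 oner_neq0.
case: (qchar_pm dM') => hM'; rewrite hM' in c1 c2; case: eta => he; rewrite he in c1 c2.
all: lia.
Qed.

Lemma det_invol_rank d (S G : 'M[F]_d) : S^T = S -> S \in unitmx -> isometry S G ->
  G *m G = 1%:M -> \det G = (-1) ^+ \rank (1%:M - G).
Proof.
move=> sS uS iG GG; have [r rG] : exists r, \rank (1%:M - G) = r by exists (\rank (1%:M - G)).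
have dE : d = (r + (d - r))%N by rewrite subnKC // -rG rank_leq_row.
rewrite rG; move: (d - r)%N dE => s dE; subst d.
have [R [R' [uP _ RG R'G]]] := invol_split hodd sS uS iG GG rG.
exact: det_invol uP RG R'G.
Qed.

Lemma even_invol_frame d r (S G : 'M[F]_d) : S^T = S -> S \in unitmx -> isometry S G ->
  G *m G = 1%:M -> \rank (1%:M - G) = r -> (r < d)%N -> ~~ odd d -> ~~ odd r ->
  ~~ odd_perm (sphere_perm S G) -> exists2 A, A \in frames r S & G = frame_invol S A.
Proof.
move=> sS uS iG GG rG rd od or oG.
have [s dE] : exists s, d = (r + s.+1)%N.
  by exists (d - r.+1)%N; rewrite -addSnnS subnKC.
subst d; rewrite oddD (negPf or) /= in od.
have [R [R' [uP e RG R'G]]] := invol_split hodd sS uS iG GG rG.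
apply: (invol_frame hodd sS uS uP e RG R'G).
by apply: (odd_sphere_perm_invol _ _ _ _ sS uS iG uP e RG R'G oG); rewrite ?addnS.
Qed.

Lemma even_frame_invol_comm d k (S : 'M[F]_d) (A : 'M_(k.*2, d)) : (k.*2 < d)%N ->
  S^T = S -> S \in unitmx -> A \in frames k.*2 S ->
  exists a, exists j, [/\ isometry S a, isometry S j, \det a = 1, \det j = 1 &
    a *m j = frame_invol S A *m j *m a].
Proof.
move=> kd; have [s dE] : exists s, d = (k + k + s.+1)%N.
  by exists (d - k.*2.+1)%N; rewrite addnn -addSnnS subnKC.
subst d; move: A; rewrite -addnn => A sS uS hA.
exact: frame_invol_comm.
Qed.

End SphereSignInvolution.

(** * Involutions in the derived subgroup *)

Section DerivedSubgroup.

Local Open Scope group_scope.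
Variables (gT : finGroupType) (G : {group gT}).

Lemma der_sub1 : [~: G, G] \subset G.
Proof.
by rewrite gen_subG; apply/subsetP => _ /imset2P[x y xG yG ->]; rewrite groupR.
Qed.

Lemma mem_der1 x y : x \in G -> y \in G -> x * y * x^-1 * y^-1 \in [~: G, G].
Proof.
move=> xG yG; have -> : x * y * x^-1 * y^-1 = [~ x^-1, y^-1].
  by rewrite /commg /conjg !invgK !mulgA.
by rewrite mem_commg ?groupV.
Qed.

(** A homomorphism to Z/2 in boolean form. Additivity is asked only on [G], because the sphere sign
    is known to be multiplicative only on isometries. *)
Lemma der1_ker (f : gT -> bool) g :
  {in G &, forall x y, f (x * y) = f x (+) f y} -> g \in [~: G, G] -> f g = false.
Proof.
move=> fM; have f1 : f 1 = false.
  by have := fM 1 1 (group1 G) (group1 G); rewrite mulg1; case: (f 1).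
have fV x : x \in G -> f x^-1 = f x.
  move=> xG; have := fM x x^-1 xG; rewrite groupV mulgV f1 => /(_ xG).
  by do 2!case: (f _).
have KG : group_set [set x in G | ~~ f x].
  apply/group_setP; split=> [|x y]; rewrite !inE ?group1 ?f1 //.
  by move=> /andP[xG xf] /andP[yG yf]; rewrite groupM // fM // (negPf xf) (negPf yf).
suff /subsetP sK : [~: G, G] \subset Group KG.
  by move=> /sK; rewrite /= inE => /andP[_ /negbTE].
rewrite gen_subG; apply/subsetP => _ /imset2P[x y xG yG ->].
rewrite /= inE groupR //= /commg /conjg !fM ?groupM ?groupV // !fV //.
by do 2!case: (f _).
Qed.

End DerivedSubgroup.

Section GroupLevel.

Variables (F : finFieldType) (delta : F).
Hypothesis hodd : odd #|F|.
Variables (s : sgn) (n : nat).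
Hypothesis n1 : (1 < n)%N.

Let d := n.*2.-1.+1.
Variable S : 'M[F]_d.
Hypothesis sS : S^T = S.
Hypothesis uS : S \in unitmx.
Hypothesis qformE : forall x, qform delta s x = (x *m S *m x^T) 0 0.

Let dE : d = n.*2.
Proof. by rewrite /d prednK // double_gt0 ltnW. Qed.

(** Preserving the quadratic form gives back the Gram matrix: G S G^T - S is symmetric with
    vanishing quadratic form, hence zero by [mx_anisotropic]. *)
Lemma mem_Ogrp g : (g \in Ogrp delta s n) = isometry S (GLval g).
Proof.
rewrite inE; apply/forallP/idP => [h|/isometryP GS x]; last first.
  by rewrite !qformE trmx_mul !mulmxA -!(mulmxA x) GS.
rewrite /isometry -subr_eq0; set D := _ - S; apply: contraT => D0.
have sD : D^T = D by rewrite /D linearB /= (sym_congr _ sS) sS.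
have [v] := mx_anisotropic hodd sD D0.
have := h v; rewrite !qformE trmx_mul !mulmxA => /eqP e.
by rewrite /D mulmxBr mulmxBl !mulmxA mxE [X in _ + X]mxE e subrr eqxx.
Qed.

Lemma GL_of_unit (X : 'M[F]_d) : X \in unitmx -> exists g : {'GL_(n.*2)[F]}, GLval g = X.
Proof. by move=> uX; exists (FinRing.unit _ uX). Qed.

Lemma mem_SOgrp g : (g \in SOgrp delta s n) = isometry S (GLval g) && (\det (GLval g) == 1).
Proof. by rewrite in_set mem_Ogrp. Qed.

Lemma Omega_sub g : g \in Omega delta s n ->
  [/\ isometry S (GLval g), \det (GLval g) = 1 & ~~ odd_perm (sphere_perm S (GLval g))].
Proof.
move=> gO.
have gS : g \in SOgrp delta s n by apply: (subsetP (der_sub1 (SOgrp_group delta s n))).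
have gf : ~~ odd_perm (sphere_perm S (GLval g)).
  apply/negbT.
  apply: (der1_ker (G := SOgrp_group delta s n) (f := fun g => odd_perm (sphere_perm S (GLval g)))) gO => x y.
  rewrite !mem_SOgrp => /andP[ix _] /andP[iy _].
  by rewrite GL_MxE sphere_permM // odd_permM.
by move: gS; rewrite mem_SOgrp => /andP[-> /eqP ->].
Qed.

Lemma comm_Omega a j f : isometry S a -> isometry S j -> \det a = 1 -> \det j = 1 ->
  a *m j = f *m j *m a -> exists2 g, g \in Omega delta s n & GLval g = f.
Proof.
move=> ia ij da dj e.
have [ga gaE] := GL_of_unit (isometry_unit uS ia).
have [gj gjE] := GL_of_unit (isometry_unit uS ij).
have [gaS gjS] : ga \in SOgrp delta s n /\ gj \in SOgrp delta s n.
  by rewrite !mem_SOgrp ?gaE ?gjE ?ia ?ij ?da ?dj eqxx.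
have := mem_der1 (G := SOgrp_group delta s n) gaS gjS.
eexists; first by eassumption.
rewrite !GL_MxE !GL_VxE gaE gjE.
have ua := isometry_unit uS ia; have uj := isometry_unit uS ij.
by rewrite e mulmxK // mulmxK.
Qed.

Lemma GL_sqr_eq1 (g : {'GL_(n.*2)[F]}) : (g ^+ 2 == 1)%g = (GLval g *m GLval g == 1%:M).
Proof. by rewrite -GL_MxE -val_eqE. Qed.

Let T := [set g in Omega delta s n | (g ^+ 2 == 1)%g].
Let rk (g : {'GL_(n.*2)[F]}) := \rank (1%:M - GLval g).

Lemma Omega_involP g : g \in T -> [/\ isometry S (GLval g), \det (GLval g) = 1,
  ~~ odd_perm (sphere_perm S (GLval g)) & GLval g *m GLval g = 1%:M].
Proof. by rewrite inE GL_sqr_eq1 => /andP[/Omega_sub[? ? ?] /eqP]. Qed.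

Lemma Omega_invol_rank_even g : g \in T -> ~~ odd (rk g).
Proof.
move=> /Omega_involP[ig dg _ gg]; have := det_invol_rank hodd sS uS ig gg; rewrite dg -signr_odd.
rewrite -/(rk g); case: odd => // /eqP; rewrite expr1 eq_opp0 //.
by rewrite oner_eq0.
Qed.

(** The sphere sign forces each such involution to come from a frame; conversely, the explicit
    commutator puts each frame involution in the derived subgroup. Both directions use the nonzero
    complement granted by k < n. *)
Lemma card_Omega_invol_rank k : (0 < k < n)%N ->
  #|[set g in T | rk g == k.*2]| = #|[set frame_invol S A | A in frames k.*2 S]|.
Proof.
case/andP => k0 kn; have k2 : (k.*2 < d)%N by rewrite dE ltn_double.
have IG : injective (@GLval n.*2 F) by apply: val_inj.
rewrite -(card_imset _ IG); apply: eq_card => X; apply/imsetP/imsetP.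
  case=> g; rewrite inE => /andP[/Omega_involP[ig dg og gg] /eqP rg ->].
  have [||A hA GE] := even_invol_frame hodd sS uS ig gg rg k2 _ _ og.
  - by rewrite dE odd_double.
  - by rewrite odd_double.
  by exists A.
case=> A hA ->.
have [a [j [ia ij da dj e]]] := even_frame_invol_comm hodd k2 sS uS hA.
have [g gO gE] := comm_Omega ia ij da dj e.
exists g; last by rewrite gE.
by rewrite !inE gO GL_sqr_eq1 /rk gE frame_invol_sqr // rank_frame_invol // !eqxx.
Qed.

(** [e] collects the ranks 0 and 2n, where the only candidates are 1 and -1. A bound suffices, since
    these terms disappear in the limit. *)
Lemma num_sqrt1_Omega : exists2 e, (e <= 2)%N &
  num_sqrt1 (Omega delta s n) =
    (e + \sum_(1 <= k < n) #|[set frame_invol S A | A in frames k.*2 S]|)%N.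
Proof.
have IG : injective (@GLval n.*2 F) by apply: val_inj.
have c1 r (Y : 'M[F]_d) : (forall g, g \in T -> rk g = r -> GLval g = Y) ->
    (#|[set g in T | rk g == r]| <= 1)%N.
  move=> h; rewrite -(card_imset _ IG) -(cards1 Y) subset_leq_card //.
  apply/subsetP => _ /imsetP[g + ->]; rewrite inE => /andP[gT /eqP rg].
  by rewrite inE (h g).
exists (#|[set g in T | rk g == 0%N]| + #|[set g in T | rk g == n.*2]|)%N.
  rewrite -[2%N]/(1 + 1)%N leq_add //.
    apply: (c1 _ 1%:M) => g _ /eqP; rewrite mxrank_eq0 subr_eq0 => /eqP //.
  apply: (c1 _ (- 1%:M)) => g /Omega_involP[_ _ _ gg] rg.
  (* Full rank makes 1 - g invertible, and (1 - g)(1 + g) = 0 then forces g = -1. *)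
  have uX : 1%:M - GLval g \in unitmx.
    by rewrite -row_free_unit /row_free -/(rk g) rg; apply/eqP/esym/dE.
  apply/eqP; rewrite -subr_eq0 opprK; apply/eqP/(can_inj (mulKmx uX)).
  by rewrite mulmx0 mulmxDr mulmx1 mulmxBl gg mul1mx addrA subrK subrr.
have -> : num_sqrt1 (Omega delta s n) = #|T|.
  by rewrite /num_sqrt1; apply: eq_card => g; rewrite !inE.
have hk g : g \in T -> (rk g)./2 \in iota 0 n.+1.
  move=> gT; rewrite mem_iota /= add0n ltnS -[X in (_ <= X)%N]doubleK.
  by rewrite half_leq // -dE rank_leq_row.
have -> : #|T| = (\sum_(0 <= k < n.+1) #|[set g in T | rk g == k.*2]|)%N.
  rewrite -sum1_card (eq_bigr (fun g => \sum_(0 <= k < n.+1) (rk g == k.*2))%N); last first.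
    move=> g gT; have := odd_double_half (rk g); rewrite (negPf (Omega_invol_rank_even gT)) add0n => e.
    rewrite (eq_bigr (fun k => nat_of_bool (k == (rk g)./2))) => [|k _]; last first.
      by rewrite -[X in X == _]e (inj_eq double_inj) eq_sym.
    rewrite (bigD1_seq (rk g)./2) ?iota_uniq //=; last exact: hk.
    by rewrite eqxx big1 // => i /negPf ->.
  rewrite exchange_big /=; apply: eq_bigr => k _.
  by rewrite -big_mkcondr /= -sum1dep_card.
rewrite big_nat_recr //= big_ltn ?(ltnW n1) //= addnAC double0.
congr (_ + _)%N; apply: eq_big_nat => k; exact: card_Omega_invol_rank.
Qed.

End GroupLevel.

(** * Gram matrices of the quadratic forms *)

Section GramMatrix.

Variables (F : finFieldType) (delta : F).
Hypothesis hodd : odd #|F|.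
Hypothesis hdelta : ~ exists x : F, x ^+ 2 = delta.

Lemma quad_delta d (x y : 'rV[F]_d) i j :
  x *m delta_mx i j *m y^T = (x 0 i * y 0 j)%:M.
Proof.
rewrite -(mul_delta_mx (0 : 'I_1)) mulmxA -colE -mulmxA -rowE -tr_col.
by apply: mx11_eq; rewrite !mxE big_ord1 !mxE eqxx mulr1n.
Qed.

Section Dimension.

Variable d : nat.
Local Notation e i := (inord i : 'I_d.+1).

Definition hyperbolic_gram m : 'M[F]_d.+1 :=
  \sum_(i < m) 2^-1 *: (delta_mx (e i.*2) (e i.*2.+1) + delta_mx (e i.*2.+1) (e i.*2)).

Lemma hyperbolic_gramT m : (hyperbolic_gram m)^T = hyperbolic_gram m.
Proof.
rewrite linear_sum; apply: eq_bigr => i _.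
by rewrite linearZ linearD /= !trmx_delta addrC.
Qed.

Lemma hyperbolic_gramE m (x y : 'rV[F]_d.+1) :
  x *m hyperbolic_gram m *m y^T = (\sum_(i < m)
    2^-1 * (x 0 (e i.*2) * y 0 (e i.*2.+1) + x 0 (e i.*2.+1) * y 0 (e i.*2)))%:M.
Proof.
rewrite mulmx_sumr mulmx_suml raddf_sum; apply: eq_bigr => i _ /=.
by rewrite -scalemxAr -scalemxAl mulmxDr mulmxDl !quad_delta -raddfD scale_scalar_mx.
Qed.

Lemma inord_eq i j : (i <= d)%N -> (j <= d)%N -> (e i == e j) = (i == j).
Proof. by move=> id jd; rewrite -val_eqE /= !inordK. Qed.

Lemma delta_entry i j : (i <= d)%N -> (j <= d)%N ->
  (delta_mx (0 : 'I_1) (e j) : 'rV[F]_d.+1) 0 (e i) = (i == j)%:R.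
Proof. by move=> id jd; rewrite mxE eqxx inord_eq. Qed.

Lemma hyperbolic_gram_even m i (x : 'rV[F]_d.+1) : (m.*2 <= d.+1)%N -> (i.*2.+1 <= d)%N ->
  (x *m hyperbolic_gram m *m (delta_mx (0 : 'I_1) (e i.*2))^T) 0 0
    = if (i < m)%N then 2^-1 * x 0 (e i.*2.+1) else 0.
Proof.
move=> md id; rewrite hyperbolic_gramE mxE eqxx mulr1n.
rewrite (eq_bigr (fun k : 'I_m => if k == i :> nat then 2^-1 * x 0 (e i.*2.+1) else 0)).
  rewrite -big_mkcond /=; case: ifP => im; first by rewrite (big_pred1 (Ordinal im)).
  by rewrite big_pred0 // => k; apply/eqP => ki; rewrite -ki ltn_ord in im.
move=> k _; have kd : (k.*2.+1 <= d)%N.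
  by rewrite -ltnS (leq_trans _ md) // -doubleS leq_double.
rewrite !delta_entry ?(ltnW id) ?(ltnW kd) // (inj_eq double_inj).
have -> : (k.*2.+1 == i.*2) = false.
  by apply/eqP => /(congr1 odd); rewrite /= !odd_double.
by case: eqP => [->|_]; rewrite !mulr0 add0r ?mulr1 // mulr0.
Qed.

Lemma hyperbolic_gram_odd m i (x : 'rV[F]_d.+1) : (m.*2 <= d.+1)%N -> (i.*2.+1 <= d)%N ->
  (x *m hyperbolic_gram m *m (delta_mx (0 : 'I_1) (e i.*2.+1))^T) 0 0
    = if (i < m)%N then 2^-1 * x 0 (e i.*2) else 0.
Proof.
move=> md id; rewrite hyperbolic_gramE mxE eqxx mulr1n.
rewrite (eq_bigr (fun k : 'I_m => if k == i :> nat then 2^-1 * x 0 (e i.*2) else 0)).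
  rewrite -big_mkcond /=; case: ifP => im; first by rewrite (big_pred1 (Ordinal im)).
  by rewrite big_pred0 // => k; apply/eqP => ki; rewrite -ki ltn_ord in im.
move=> k _; have kd : (k.*2.+1 <= d)%N.
  by rewrite -ltnS (leq_trans _ md) // -doubleS leq_double.
rewrite !delta_entry ?(ltnW id) ?(ltnW kd) // eqSS (inj_eq double_inj).
have -> : (k.*2 == i.*2.+1) = false.
  by apply/eqP => /(congr1 odd); rewrite /= !odd_double.
by case: eqP => [->|_]; rewrite !mulr0 addr0 ?mulr1 // mulr0.
Qed.

(** As [d] is odd, the coordinates fall into pairs 2i, 2i + 1. A vector of the radical is orthogonal
    to both basis vectors of each pair, so nondegeneracy can be checked one pair at a time. *)
Lemma unitmx_radical (S : 'M[F]_d.+1) : odd d ->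
  (forall (x : 'rV_d.+1) i, (i.*2.+1 <= d)%N ->
    (x *m S *m (delta_mx (0 : 'I_1) (e i.*2))^T) 0 0 = 0 ->
    (x *m S *m (delta_mx (0 : 'I_1) (e i.*2.+1))^T) 0 0 = 0 ->
    x 0 (e i.*2) = 0 /\ x 0 (e i.*2.+1) = 0) -> S \in unitmx.
Proof.
move=> od h; rewrite -row_free_unit; apply: inj_row_free => x xS.
apply/rowP => k; rewrite mxE.
have kd : ((k : nat)./2.*2.+1 <= d)%N.
  rewrite -[X in (_ <= X)%N](odd_double_half d) od add1n ltnS leq_double.
  by rewrite half_leq // -ltnS.
have [|| x0 x1] := h x k./2 kd; rewrite ?xS ?mul0mx ?mxE //.
rewrite -[k]inord_val -[val k]odd_double_half; case: (odd (val k)); first exact: x1.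
exact: x0.
Qed.

End Dimension.

Lemma qform_gram s n : (1 < n)%N -> exists S : 'M[F]_(n.*2.-1.+1),
  [/\ S^T = S, S \in unitmx & forall x, qform delta s x = (x *m S *m x^T) 0 0].
Proof.
move=> n1; have h2 := two_neq0 hodd.
have hq m d (x : 'rV[F]_d.+1) : (x *m hyperbolic_gram d m *m x^T) 0 0
    = \sum_(i < m) x 0 (inord i.*2) * x 0 (inord i.*2.+1).
  rewrite hyperbolic_gramE mxE eqxx mulr1n; apply: eq_bigr => i _.
  by field.
have n2 : (0 < n.*2)%N by rewrite double_gt0 ltnW.
have od : odd n.*2.-1 by rewrite -subn1 oddB // odd_double.
case: s.
  exists (hyperbolic_gram n.*2.-1 n); split=> [||x]; last by rewrite hq.
    exact: hyperbolic_gramT.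
  apply: unitmx_radical => // x i id.
  rewrite hyperbolic_gram_even ?hyperbolic_gram_odd ?prednK //.
  have -> : (i < n)%N by rewrite -ltn_double -[n.*2]prednK // ltnS ltnW.
  move=> /eqP + /eqP; rewrite !mulf_eq0 invr_eq0 (negPf h2) /=.
  by move=> /eqP -> /eqP ->.
have d0 : delta != 0 by apply/eqP => d0; apply: hdelta; exists 0; rewrite expr0n d0.
set d := n.*2.-1; set m := n.-1; set a : 'I_d.+1 := inord m.*2; set b : 'I_d.+1 := inord m.*2.+1.
have mE : (m.*2.+1 = d)%N by rewrite /d /m -{2}(prednK (ltnW n1)) doubleS.
exists (hyperbolic_gram d m + delta_mx a a - delta *: delta_mx b b).
have Sxy (x y : 'rV[F]_d.+1) : (x *m (hyperbolic_gram d m + delta_mx a a - delta *: delta_mx b b) *m y^T) 0 0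
    = (x *m hyperbolic_gram d m *m y^T) 0 0 + x 0 a * y 0 a - delta * (x 0 b * y 0 b).
  rewrite mulmxBr mulmxDr mulmxBl mulmxDl -scalemxAr -scalemxAl !quad_delta.
  by move: (_ *m hyperbolic_gram d m *m _) => X; rewrite !mxE eqxx !mulr1n.
split=> [||x]; last by rewrite Sxy hq /= !expr2 -/a -/b.
  rewrite linearB linearD /= linearZ /= !trmx_delta hyperbolic_gramT //.
have md : (m.*2 <= d.+1)%N by rewrite -mE ltnW // ltnW.
apply: unitmx_radical => // x i id; rewrite !Sxy.
rewrite (hyperbolic_gram_even _ md id) (hyperbolic_gram_odd _ md id).
have [m0 m1] : (m.*2 <= d)%N /\ (m.*2.+1 <= d)%N by rewrite mE; split=> //; rewrite -mE.
rewrite !delta_entry ?(ltnW id) // ?eqSS !(inj_eq double_inj).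
have -> : (m.*2 == i.*2.+1) = false.
  by apply/eqP => /(congr1 odd); rewrite /= !odd_double.
have -> : (m.*2.+1 == i.*2) = false.
  by apply/eqP => /(congr1 odd); rewrite /= !odd_double.
have im : (i <= m)%N by rewrite -leq_double -ltnS mE.
rewrite !mulr0 subr0 addr0.
(* The last pair i = m is the plane x^2 - delta y^2; the pairs below it are hyperbolic. *)
move: im; rewrite leq_eqVlt => /orP[/eqP ->|im].
  rewrite ltnn eqxx !mulr1 !add0r -/a -/b => -> /eqP.
  by rewrite oppr_eq0 mulf_eq0 (negPf d0) => /eqP.
rewrite im (gtn_eqF im) !mulr0 subr0 addr0 => /eqP + /eqP.
by rewrite !mulf_eq0 invr_eq0 (negPf h2) /= => /eqP -> /eqP ->.
Qed.

End GramMatrix.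

(** * Gaussian binomials and the triple product *)

Section GaussianBinomial.

Variables (R : realFieldType) (y : R).
Hypothesis y0 : 0 < y.
Hypothesis y4 : y <= 1 / 4.

(** The q-Pochhammer symbol (y; y)_n; in the application y = q^-2, whence the bound 1/4. *)
Definition qfact (n : nat) : R := \prod_(i < n) (1 - y ^+ i.+1).

Lemma qfact0 : qfact 0 = 1.
Proof. exact: big_ord0. Qed.

Lemma qfactS n : qfact n.+1 = qfact n * (1 - y ^+ n.+1).
Proof. exact: big_ord_recr. Qed.

Lemma exprn_quarter_bounds n : 0 < y ^+ n <= 1.
Proof. by rewrite exprn_gt0 //= exprn_ile1 ?ltW //; move: y4; lra. Qed.

(** The bound 1/2 alone is not inductive; the extra y^n / 2 pays for the next factor, because
    y^(n+1) is at most y^n / 4. *)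
Lemma qfact_lb n : 1 / 2 + y ^+ n / 2 <= qfact n.
Proof.
elim: n => [|n IH]; first by rewrite /qfact big_ord0 expr0; lra.
rewrite qfactS; have /andP[h0 h1] := exprn_quarter_bounds n; have /andP[g0 g1] := exprn_quarter_bounds n.+1.
have e : y ^+ n.+1 <= y ^+ n / 4 by rewrite exprS; move: y4 h0; nra.
have := ler_wpM2r (_ : 0 <= 1 - y ^+ n.+1) IH; rewrite subr_ge0 g1 => /(_ isT).
apply: le_trans; nra.
Qed.

Lemma qfact_bounds n : 1 / 2 <= qfact n <= 1.
Proof.
apply/andP; split; first by have := qfact_lb n; have := exprn_quarter_bounds n; lra.
elim: n => [|n IH]; first by rewrite /qfact big_ord0.
rewrite qfactS; have := exprn_quarter_bounds n.+1; have := qfact_lb n; have := exprn_quarter_bounds n; nra.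
Qed.

Lemma qfact_neq0 n : qfact n != 0.
Proof. by apply: lt0r_neq0; have := qfact_bounds n; lra. Qed.

Lemma qfact_close a b : (a <= b)%N -> 0 <= qfact a - qfact b <= y ^+ a.
Proof.
(* Strengthened to telescope: one more factor costs at most y^(n+1), which is below y^n -
   y^(n+1). *)
move=> ab; suff : 0 <= qfact a - qfact b <= y ^+ a - y ^+ b by have := exprn_quarter_bounds b; lra.
rewrite -(subnKC ab); elim: (b - a)%N => [|k IH]; first by rewrite addn0 !subrr lexx.
rewrite addnS qfactS; have := qfact_bounds (a + k); have := exprn_quarter_bounds (a + k).
have : y ^+ (a + k).+1 <= y ^+ (a + k) / 4.
  by rewrite exprS; have := exprn_quarter_bounds (a + k); move: y4; nra.
have := exprn_quarter_bounds (a + k).+1; move: IH; nra.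
Qed.

Definition qbin (n k : nat) : R :=
  if (k <= n)%N then qfact n / (qfact k * qfact (n - k)) else 0.

Lemma qbin0 n : qbin n 0 = 1.
Proof. by rewrite /qbin /= subn0 qfact0 mul1r divff ?qfact_neq0. Qed.

Lemma qbinn n : qbin n n = 1.
Proof. by rewrite /qbin leqnn subnn qfact0 mulr1 divff ?qfact_neq0. Qed.

Lemma qbin_small n k : (n < k)%N -> qbin n k = 0.
Proof. by rewrite /qbin ltnNge => /negbTE ->. Qed.

(** Of the two q-Pascal rules, this is the one produced by distributing a new last factor in
    [qbinomial]. *)
Lemma qbinS n k : (k <= n)%N -> qbin n.+1 k.+1 = qbin n k.+1 + y ^+ (n - k) * qbin n k.
Proof.
rewrite /qbin ltnS subSS => kn; rewrite kn; have := ltnP k n; case: ifP => [kn' _|kn' _].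
  have [m nE] : exists m, n = (k + m.+1)%N by exists (n - k.+1)%N; rewrite addnS -addSn subnKC.
  rewrite nE addKn (_ : (k + m.+1 - k.+1)%N = m); last by rewrite -addSnnS addKn.
  rewrite (qfactS (k + m.+1)) (qfactS k) (qfactS m).
  have n1 := qfact_neq0 k.+1; have n2 := qfact_neq0 m.+1.
  rewrite qfactS mulf_eq0 negb_or in n1; rewrite qfactS mulf_eq0 negb_or in n2.
  case/andP: n1 => n1 n1'; case/andP: n2 => n2 n2'.
  rewrite -addSn exprD; move: (qfact _) (qfact k) (qfact m) n1 n2 n1' n2'.
  by move=> *; field; apply/and4P.
have {kn kn'} -> : n = k by apply/eqP; rewrite eqn_leq kn leqNgt kn'.
by rewrite subnn qfact0 expr0 add0r mul1r !mulr1 !divff ?qfact_neq0.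
Qed.

(** Rothe's finite form of the q-binomial theorem. *)
Lemma qbinomial N (w : R) :
  \prod_(i < N) (1 + y ^+ i * w) = \sum_(j < N.+1) qbin N j * y ^+ 'C(j, 2) * w ^+ j.
Proof.
elim: N => [|N IH]; first by rewrite big_ord0 big_ord1 qbin0 !expr0 !mulr1.
rewrite big_ord_recr /= IH mulrDr mulr1 [RHS]big_ord_recl qbin0.
rewrite [X in X + _](_ : _ = \sum_(j < N.+2) qbin N j * y ^+ 'C(j, 2) * w ^+ j); last first.
  by rewrite [RHS]big_ord_recr /= qbin_small // !mul0r addr0.
rewrite [X in X + _ = _]big_ord_recl qbin0 -addrA; congr (_ + _).
rewrite mulr_suml -big_split; apply: eq_bigr => j _ /=.
have jN : (j <= N)%N by rewrite -ltnS.
rewrite /bump /= !add1n qbinS // binS bin1 exprD.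
have -> : y ^+ N = y ^+ (N - j) * y ^+ j by rewrite -exprD subnK.
by rewrite exprS; ring.
Qed.

End GaussianBinomial.

(* For [k <= n] this is [(n - 2 k) ^ 2], written so as to avoid an absolute value. *)
Definition sqr_gap (n k : nat) : nat := (n ^ 2 - 4 * k * (n - k))%N.

Lemma sqr_gapE n k : (k <= n)%N -> (4 * k * (n - k) + sqr_gap n k = n ^ 2)%N.
Proof.
rewrite /sqr_gap => kn; rewrite subnKC //.
have [l ->] : exists l, n = (k + l)%N by exists (n - k)%N; rewrite subnKC.
by rewrite addKn -mulnA nat_AGM2.
Qed.

(** With n = k + l both bounds reduce to |k - l| / 2 <= (k - l)^2. Thus the Gaussian weight makes up
    for the factors x^k and x^l that are not small near the ends of the sum. *)
Lemma half_le_sqr_gap n k : (k <= n)%N -> (n./2 <= sqr_gap n k + k)%N /\ (n./2 <= sqr_gap n k + (n - k))%N.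
Proof.
move=> kn; have := sqr_gapE kn; move: (sqr_gap n k) => w; have [l ->] : exists l, n = (k + l)%N.
  by exists (n - k)%N; rewrite subnKC.
by rewrite addKn => h; split; nia.
Qed.

Section FiniteTripleProduct.

Variables (R : realFieldType) (q : R).
Hypothesis q2 : 2 <= q.
Let x := q^-1.

(** This is [qbinomial] with 2n factors, base q^-2 and w = z q^(2n-1), so that the factors are 1 + z
    q^(2n-1-2i). Those with i >= n are already 1 + z / q^(odd). Each of the others is z q^m (1 + z /
    q^m) with m odd, because z^2 = 1; hence the square of the product. *)
Lemma triple_product n (z : R) : z = 1 \/ z = -1 ->
  z ^+ n * \prod_(1 <= i < n.+1) (1 + z / q ^+ (2 * i - 1)) ^+ 2
   = \sum_(j < n.*2.+1) qbin (x ^+ 2) n.*2 j * z ^+ j * (q ^+ (2 * n * j - j ^ 2) / q ^+ (n ^ 2)).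
Proof.
move=> hz; have q0 : q != 0 by apply: lt0r_neq0; move: q2; lra.
have y0 : 0 < x ^+ 2 by rewrite exprn_gt0 // invr_gt0; move: q2; lra.
have y4 : x ^+ 2 <= 1 / 4.
  have x0 : 0 < x by rewrite invr_gt0; move: q2; lra.
  have x2 : x <= 1 / 2 by rewrite /x -div1r ler_pdivrMr; move: q2; lra.
  by rewrite expr2; nra.
have zz : z * z = 1 by case: hz => ->; rewrite ?mulr1 ?mulrNN ?mulr1.
have := qbinomial y0 y4 n.*2 (z * q ^+ n.*2 / q).
have -> : \prod_(i < n.*2) (1 + (x ^+ 2) ^+ i * (z * q ^+ n.*2 / q))
  = z ^+ n * q ^+ (n ^ 2) * \prod_(1 <= i < n.+1) (1 + z / q ^+ (2 * i - 1)) ^+ 2.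
  rewrite -addnn big_split_ord /=.
  have -> : \prod_(i < n) (1 + (x ^+ 2) ^+ (n + i) * (z * q ^+ (n + n) / q))
      = \prod_(1 <= i < n.+1) (1 + z / q ^+ (2 * i - 1)).
    rewrite big_add1 big_mkord; apply: eq_bigr => i _ /=.
    rewrite (_ : (2 * i.+1 - 1 = i.*2.+1)%N); last by lia.
    rewrite -exprM mulnDr exprD addnn -!mul2n exprS !exprVn.
    by have := expf_neq0 (2 * n) q0; have := expf_neq0 (2 * i) q0 => *; field; apply/and3P.
  have -> : \prod_(i < n) (1 + (x ^+ 2) ^+ i * (z * q ^+ (n + n) / q))
      = z ^+ n * q ^+ (n ^ 2) * \prod_(1 <= i < n.+1) (1 + z / q ^+ (2 * i - 1)).
    rewrite (reindex_inj rev_ord_inj) /= big_add1 big_mkord.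
    (* The extracted monomials z q^(2i+1) multiply to z^n q^(n^2), as the first n odd numbers sum to
       n^2. *)
    rewrite (_ : z ^+ n * q ^+ (n ^ 2) = \prod_(i < n) (z * q ^+ (2 * i).+1)).
      rewrite -big_split; apply: eq_bigr => i _ /=.
      rewrite (_ : (2 * i.+1 - 1 = (2 * i).+1)%N); last by lia.
      have e : (n + n = (2 * (n - i.+1)) + (2 * i).+2)%N by have := ltn_ord i; lia.
      rewrite e exprD -exprM exprVn mulrDr mulr1 mulrACA zz mul1r divff ?expf_neq0 //.
      rewrite [LHS]addrC; congr (_ + _); rewrite !exprS.
      by have := expf_neq0 (2 * (n - i.+1)) q0 => *; field; apply/andP.
    elim: (n) => [|m IH]; first by rewrite big_ord0 !expr0 mulr1.
    rewrite big_ord_recr /= -IH (_ : (m.+1 ^ 2 = m ^ 2 + (2 * m).+1)%N); last by lia.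
    by rewrite exprD exprS; ring.
  rewrite -[LHS]mulrA; congr (_ * _); rewrite -big_split; apply: eq_bigr => i _; exact: esym (expr2 _).
move=> /(congr1 (fun u => u / q ^+ (n ^ 2))).
rewrite mulrAC -(mulrA (z ^+ n)) mulfV ?expf_neq0 // mulr1 => ->.
rewrite mulr_suml; apply: eq_bigr => j _.
have jn : (j <= 2 * n)%N by rewrite mul2n -ltnS.
(* The truncated subtraction is exact because j <= 2n, and j^2 = j + 2 C(j,2). *)
have e : (n.*2 * j = (2 * n * j - j ^ 2) + j + 2 * 'C(j, 2))%N.
  have : (j ^ 2 <= 2 * n * j)%N by rewrite expnS expn1 leq_mul2r jn orbT.
  have : (j ^ 2 = j + 2 * 'C(j, 2))%N.
    rewrite bin2 mul2n; have := odd_double_half (j * j.-1).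
    by rewrite oddM; case: (nat_of_ord j) => // k; rewrite /= andNb; lia.
  by rewrite -[X in _ -> _ -> (X * _)%N = _]mul2n; lia.
have key : (x ^+ 2) ^+ 'C(j, 2) * (z * q ^+ n.*2 / q) ^+ j = z ^+ j * q ^+ (2 * n * j - j ^ 2).
  rewrite -exprM exprVn !exprMn exprVn -exprM e !exprD.
  have [? ?] := (expf_neq0 'C(j, 2) q0, expf_neq0 j q0).
  by field; apply/andP.
by rewrite -(mulrA (qbin _ _ _)) key; ring.
Qed.

(** Half the sum of the cases z = 1 and z = -1: odd j cancel, and j = 2k has exponent 4k(n - k). The
    sign (-1)^n is the prefactor z^n. *)
Lemma triple_product_even n :
  \sum_(k < n.+1) qbin (x ^+ 2) n.*2 k.*2 * (q ^+ (4 * k * (n - k)) / q ^+ (n ^ 2))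
   = 1 / 2 * (\prod_(1 <= i < n.+1) (1 + 1 / q ^+ (2 * i - 1)) ^+ 2
     + (-1) ^+ n * \prod_(1 <= i < n.+1) (1 - 1 / q ^+ (2 * i - 1)) ^+ 2).
Proof.
have := triple_product n (or_introl erefl); have := triple_product n (or_intror erefl).
under [X in _ * X = _]eq_bigr do rewrite mulN1r -div1r.
rewrite expr1n mul1r => -> ->.
rewrite -big_split /= mulr_sumr.
have sumE (f : nat -> R) : \sum_(j < n.*2.+1) f j
    = \sum_(k < n.+1) f k.*2 + \sum_(k < n) f k.*2.+1.
  elim: n => [|m IH]; first by rewrite !big_ord1 big_ord0 addr0.
  rewrite doubleS big_ord_recr big_ord_recr /= IH.
  rewrite [X in _ = X + _]big_ord_recr [X in _ = _ + X]big_ord_recr /= doubleS.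
  by ring.
rewrite (sumE (fun j => 1 / 2 * (qbin (x ^+ 2) n.*2 j * 1 ^+ j * (q ^+ (2 * n * j - j ^ 2) / q ^+ (n ^ 2)) +
   qbin (x ^+ 2) n.*2 j * (-1) ^+ j * (q ^+ (2 * n * j - j ^ 2) / q ^+ (n ^ 2))))).
rewrite [X in _ = _ + X]big1 ?addr0 => [|k _]; last first.
  by rewrite -signr_odd /= odd_double expr1n expr1; ring.
apply: eq_bigr => k _; rewrite -signr_odd odd_double expr1n expr0 mulr1.
rewrite (_ : (2 * n * k.*2 - k.*2 ^ 2 = 4 * k * (n - k))%N).
  by move: (q ^+ _ / _) => t; field.
by have := ltn_ord k; nia.
Qed.

End FiniteTripleProduct.

(** * Asymptotics *)

Section Estimate.

Variables (R : realFieldType) (q : R).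
Hypothesis q2 : 2 <= q.
Let x := q^-1.

Let x0 : 0 < x. Proof. by rewrite invr_gt0; move: q2; lra. Qed.
Let x2 : x <= 1 / 2. Proof. by rewrite /x -div1r ler_pdivrMr; move: q2; lra. Qed.
Let y0 : 0 < x ^+ 2. Proof. by rewrite exprn_gt0. Qed.
Let y4 : x ^+ 2 <= 1 / 4. Proof. by rewrite expr2; move: x0 x2; nra. Qed.

Lemma exprn_half_bounds k : 0 < x ^+ k <= 1.
Proof. by rewrite exprn_gt0 //= exprn_ile1 ?ltW //; move: x2; lra. Qed.

Lemma exprn_le_half k : (0 < k)%N -> x ^+ k <= 1 / 2.
Proof.
by case: k => // k _; rewrite exprS; have := exprn_half_bounds k; move: x0 x2; nra.
Qed.

Lemma sqr_exprn_le k : (x ^+ 2) ^+ k <= x ^+ k.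
Proof. by rewrite -exprM mul2n -addnn exprD; have := exprn_half_bounds k; nra. Qed.

(** Each of the three factorials moves by at most x^m when its index m is doubled. The difference of
    fractions then has numerator at most 3/2 (x^k + x^l) and denominator at least 1/16, which gives
    24. *)
Lemma qbin_double_close k l :
  `|qbin (x ^+ 2) (k + l) k - qbin (x ^+ 2) (k + l).*2 k.*2| <= 24 * (x ^+ k + x ^+ l).
Proof.
have hb n := qfact_bounds y0 y4 n.
have hc n : `|qfact (x ^+ 2) n - qfact (x ^+ 2) n.*2| <= x ^+ n.
  have := qfact_close y0 y4 (leq_addr n n); rewrite addnn => h.
  by rewrite ger0_norm; have := sqr_exprn_le n; lra.
rewrite /qbin leq_addr doubleD leq_addr !addKn.
have := hc (k + l)%N; have := hc k; have := hc l; rewrite doubleD.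
have xkl : x ^+ (k + l) <= (x ^+ k + x ^+ l) / 2.
  by rewrite exprD; have := exprn_half_bounds k; have := exprn_half_bounds l; nra.
have := hb (k + l)%N; have := hb k; have := hb l.
have := hb (k.*2 + l.*2)%N; have := hb k.*2; have := hb l.*2.
move: (qfact _ (k + l)) (qfact _ k) (qfact _ l) => a b c.
move: (qfact _ (k.*2 + l.*2)) (qfact _ k.*2) (qfact _ l.*2) => a' b' c'.
move=> /andP[c0' c1'] /andP[b0' b1'] /andP[a0' a1'] /andP[c0 c1] /andP[b0 b1] /andP[a0 a1] dc db da.
have -> : a / (b * c) - a' / (b' * c') = (a * b' * c' - a' * b * c) / (b * c * (b' * c')).
  by field; apply/and4P; split; apply: lt0r_neq0; lra.
rewrite normrM normfV [`|b * c * _|]gtr0_norm; last by rewrite !mulr_gt0 //; lra.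
have num : `|a * b' * c' - a' * b * c| <= 3 / 2 * (x ^+ k + x ^+ l).
  have -> : a * b' * c' - a' * b * c = (a - a') * (b' * c') - a' * ((b - b') * c' + b * (c - c')).
    by ring.
  apply: le_trans (ler_normB _ _) _; rewrite !normrM.
  have e1 : `|a - a'| * (`|b'| * `|c'|) <= (x ^+ k + x ^+ l) / 2.
    rewrite (ger0_norm (_ : 0 <= b')) ?(ger0_norm (_ : 0 <= c')); try lra.
    apply: le_trans xkl; apply: le_trans da.
    by rewrite ler_piMr // mulr_ile1; lra.
  have e2 : `|a'| * `|(b - b') * c' + b * (c - c')| <= x ^+ k + x ^+ l.
    rewrite (ger0_norm (_ : 0 <= a')); try lra.
    apply: (@le_trans _ _ `|(b - b') * c' + b * (c - c')|); first by rewrite ler_piMl.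
    apply: le_trans (ler_normD _ _) _; rewrite !normrM.
    rewrite (ger0_norm (_ : 0 <= b)) ?(ger0_norm (_ : 0 <= c')); try lra.
    apply: lerD; [apply: le_trans db|apply: le_trans dc]; rewrite ?ler_piMr ?ler_piMl //; lra.
  by move: e1 e2; lra.
have den : 1 / 16 <= b * c * (b' * c').
  have bc : 1 / 4 <= b * c by nra.
  have bc' : 1 / 4 <= b' * c' by nra.
  by nra.
rewrite ler_pdivrMr; last by lra.
by apply: le_trans num _; have := exprn_half_bounds k; have := exprn_half_bounds l; nra.
Qed.

Lemma mulr_unit_bounds (a X : R) : -1 <= a <= 1 -> 0 <= X -> - X <= a * X <= X.
Proof. by move=> /andP[a1 a2] X0; apply/andP; split; nra. Qed.

(** The binomial is at most 4 and the sign factors are within 4 (x^k + x^l) of 1. With the overall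
    1/2 this costs 8, and [qbin_double_close] costs 12. *)
Lemma frame_ratio_close k l (s t u : R) : (0 < k)%N -> (0 < l)%N ->
  `|s| <= 1 -> `|t| <= 1 -> `|u| <= 1 ->
  `|1 / 2 * qbin (x ^+ 2) (k + l) k * ((1 + s * x ^+ l) * (1 + t * x ^+ k) / (1 + u * x ^+ (k + l)))
    - 1 / 2 * qbin (x ^+ 2) (k + l).*2 k.*2| <= 20 * (x ^+ k + x ^+ l).
Proof.
move=> k0 l0; rewrite !ler_norml => /andP[s1 s2] /andP[t1 t2] /andP[u1 u2].
have qb : 0 <= qbin (x ^+ 2) (k + l) k <= 4.
  have hb n := qfact_bounds y0 y4 n.
  rewrite /qbin leq_addr addKn; have := hb (k + l)%N; have := hb k; have := hb l.
  move: (qfact _ _) (qfact _ k) (qfact _ l) => a b c hc hb' ha.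
  have bc : 1 / 4 <= c * b by nra.
  by rewrite divr_ge0 ?ler_pdivrMr; nra.
have := qbin_double_close k l; rewrite !ler_norml => /andP[d1 d2].
have phi : `|(1 + s * x ^+ l) * (1 + t * x ^+ k) / (1 + u * x ^+ (k + l)) - 1|
    <= 4 * (x ^+ k + x ^+ l).
  rewrite exprD; have := exprn_half_bounds k; have := exprn_half_bounds l; have := exprn_le_half k0; have := exprn_le_half l0.
  move: (x ^+ k) (x ^+ l) => X Z Z2 X2 /andP[Z0 _] /andP[X0 _].
  have XZ : 0 < X * Z by rewrite mulr_gt0.
  have XZ4 : X * Z <= (X + Z) / 4 by nra.
  have XZ1 : X * Z <= 1 / 4 by nra.
  have st : - 1 <= s * t <= 1.
    by rewrite -ler_norml normrM mulr_ile1 ?normr_ge0 // ler_norml ?s1 ?s2 ?t1 ?t2.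
  have sZ : - Z <= s * Z <= Z by apply: mulr_unit_bounds; rewrite ?s1 ?s2 ?ltW.
  have tX : - X <= t * X <= X by apply: mulr_unit_bounds; rewrite ?t1 ?t2 ?ltW.
  have uXZ : - (X * Z) <= u * (X * Z) <= X * Z by apply: mulr_unit_bounds; rewrite ?u1 ?u2 ?ltW.
  have stXZ : - (X * Z) <= (s * t) * (X * Z) <= X * Z by apply: mulr_unit_bounds; rewrite ?st ?ltW.
  have den : 3 / 4 <= 1 + u * (X * Z) by lra.
  have -> : (1 + s * Z) * (1 + t * X) / (1 + u * (X * Z)) - 1
      = (s * Z + t * X + (s * t) * (X * Z) - u * (X * Z)) / (1 + u * (X * Z)).
    by field; apply: lt0r_neq0; lra.
  rewrite normrM normfV [`|1 + _|]gtr0_norm; last by lra.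
  rewrite ler_pdivrMr; last by lra.
  have num : `|s * Z + t * X + (s * t) * (X * Z) - u * (X * Z)| <= 3 / 2 * (X + Z).
    by rewrite ler_norml; lra.
  by apply: le_trans num _; nra.
move: phi d1 d2 qb; rewrite ler_norml.
move: ((1 + _) * (1 + _) / _) (qbin _ (k + l) k) (qbin _ _.*2 _) => P A B.
have := exprn_half_bounds k; have := exprn_half_bounds l; move: (x ^+ k) (x ^+ l) => X Z /andP[Z0 _] /andP[X0 _].
move=> /andP[p1 p2] d1 d2 /andP[A0 A4].
have h1 : 0 <= A * (P - 1 + 4 * (X + Z)) by rewrite mulr_ge0 //; lra.
have h2 : 0 <= A * (4 * (X + Z) - (P - 1)) by rewrite mulr_ge0 //; lra.
have h3 : 0 <= (4 - A) * (X + Z) by rewrite mulr_ge0 //; lra.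
have [a1 a2] : - (16 * (X + Z)) <= A * (P - 1) /\ A * (P - 1) <= 16 * (X + Z) by split; lra.
rewrite -mulrA -mulrBr; have -> : A * P - B = A * (P - 1) + (A - B) by ring.
by move: (A * (P - 1)) (A - B) a1 a2 d1 d2 => *; lra.
Qed.

End Estimate.

(** * Closed form of the number of involutions *)

Section InvolutionCount.

Variables (R : realFieldType) (F : finFieldType).
Hypothesis hodd : odd #|F|.

Let q : R := #|F|%:R.
Let x := q^-1.
Let eta : R := (qchar (-1 : F))%:~R.

Lemma card_field_ge2 : 2 <= q.
Proof. by rewrite /q ler_nat finNzRing_gt1. Qed.

Let q0 : q != 0.
Proof. by apply: lt0r_neq0; have := card_field_ge2; lra. Qed.

Let eta2 : eta ^+ 2 = 1.
Proof.
rewrite /eta; case: (@qchar_pm F (-1)) => [|->|->]; rewrite ?oppr_eq0 ?oner_neq0 //.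
  by rewrite expr1n.
by rewrite mulrN1z sqrrN expr1n.
Qed.

Lemma sphere_pair a (e : int) :
  (sphere F a.*2.+2 e * sphere F a.*2.+1 e)%:~R
    = q ^+ (4 * a).+1 * (1 - eta ^+ a.+1 * e%:~R * x ^+ a.+1) * (1 + eta ^+ a * e%:~R * x ^+ a).
Proof.
rewrite /sphere /= odd_double /= doubleK uphalf_double.
rewrite intrM intrB intrD !intrM !rmorphXn /= -/eta -pmulrn -/q.
rewrite (_ : (4 * a).+1 = a.*2.+1 + a.*2)%N; last by lia.
rewrite exprD /x !exprVn -addnn !exprS exprD.
by have := expf_neq0 a q0 => qa0; field; rewrite q0 qa0.
Qed.

Definition frame_count k l (e : int) : int :=
  \prod_(i < k.*2) sphere F ((k + l).*2 - i) e.

(** Let s_a = eta^a e. The spheres of dimensions 2a + 2 and 2a + 1 contribute (1 - s_(a+1) x^(a+1))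
    (1 + s_a x^a). The extra factor on the left completes the first of these to 1 - x^(2a+2) and
    passes 1 + s_a x^a on to the next pair, so the product telescopes into [qfact]. *)
Lemma frame_count_closed k l (e : int) : e = 1 \/ e = -1 ->
  (frame_count k l e)%:~R * (1 + eta ^+ (k + l) * e%:~R * x ^+ (k + l))
    = (\prod_(i < k) q ^+ (4 * (i + l)).+1) * (1 + eta ^+ l * e%:~R * x ^+ l)
      * (qfact (x ^+ 2) (k + l) / qfact (x ^+ 2) l).
Proof.
move=> he; have [y0 y4] : 0 < x ^+ 2 /\ x ^+ 2 <= 1 / 4.
  have x0 : 0 < x by rewrite invr_gt0; have := card_field_ge2; lra.
  have x2 : x <= 1 / 2 by rewrite /x -div1r ler_pdivrMr; have := card_field_ge2; lra.
  by split; rewrite ?exprn_gt0 // expr2; nra.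
elim: k => [|k IH].
  by rewrite /frame_count !big_ord0 divff ?(qfact_neq0 y0 y4) //= mulr1.
have -> : frame_count k.+1 l e
    = sphere F (k + l).*2.+2 e * sphere F (k + l).*2.+1 e * frame_count k l e.
  rewrite /frame_count addSn !doubleS !big_ord_recl mulrA; congr (_ * _).
rewrite intrM sphere_pair big_ord_recr /= addSn qfactS.
set a := (k + l)%N in IH *; set E : R := e%:~R in IH *.
have E2 : E ^+ 2 = 1 by rewrite /E; case: he => ->; rewrite ?mulrN1z ?sqrrN expr1n.
have sq : (eta ^+ a.+1 * E * x ^+ a.+1) ^+ 2 = (x ^+ 2) ^+ a.+1.
  by rewrite !exprMn E2 mulr1 -exprM mulnC exprM eta2 expr1n mul1r expr2.
transitivity (q ^+ (4 * a).+1 * (1 - (eta ^+ a.+1 * E * x ^+ a.+1) ^+ 2) *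
   ((frame_count k l e)%:~R * (1 + eta ^+ a * E * x ^+ a))); first by ring.
by rewrite IH sq; ring.
Qed.

(** Quotient of two instances of [frame_count_closed]. The frames inside W are the case l = 0, e =
    1, whose boundary factor 1 + x^0 = 2 is the origin of the 1/2. *)
Lemma card_frame_invols_closed k l (e : int) (c : R) : (0 < k)%N -> (0 < l)%N ->
  e = 1 \/ e = -1 -> c * (frame_count k 0 1)%:~R = (frame_count k l e)%:~R ->
  c = q ^+ (4 * k * l) * (1 / 2 * qbin (x ^+ 2) (k + l) k *
    ((1 + (eta ^+ l * e%:~R) * x ^+ l) * (1 + eta ^+ k * x ^+ k)
      / (1 + (eta ^+ (k + l) * e%:~R) * x ^+ (k + l)))).
Proof.
move=> k0 l0 he ce; have q2 := card_field_ge2.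
have [y0 y4] : 0 < x ^+ 2 /\ x ^+ 2 <= 1 / 4.
  have x0 : 0 < x by rewrite invr_gt0; move: q2; lra.
  have x2 : x <= 1 / 2 by rewrite /x -div1r ler_pdivrMr; move: q2; lra.
  by split; rewrite ?exprn_gt0 // expr2; nra.
have f1 := frame_count_closed k l he.
have f2 := frame_count_closed k 0 (or_introl erefl).
rewrite addn0 expr0 mulr1 !mul1r qfact0 divr1 in f2.
have pE : \prod_(i < k) q ^+ (4 * (i + l)).+1
    = q ^+ (4 * k * l) * \prod_(i < k) q ^+ (4 * (i + 0)).+1.
  elim: (k) => [|m IH]; first by rewrite !big_ord0 mulr1.
  rewrite !big_ord_recr /= IH addn0 (_ : (4 * m.+1 * l = 4 * m * l + 4 * l)%N); last by lia.
  by rewrite (_ : (4 * (m + l)).+1 = (4 * l + (4 * m).+1)%N) ?exprD; [ring|lia].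
have nz (m : nat) (E : R) : (0 < m)%N -> E ^+ 2 = 1 -> 1 + E * x ^+ m != 0.
  move=> m0 /eqP; rewrite sqrf_eq1 => hE; have := exprn_half_bounds q2 m; have := exprn_le_half q2 m0.
  by move=> *; apply: lt0r_neq0; case/orP: hE => /eqP ->; lra.
have sE m : (eta ^+ m) ^+ 2 = 1 by rewrite -exprM mulnC exprM eta2 expr1n.
have sE' m : (eta ^+ m * e%:~R) ^+ 2 = 1.
  by rewrite exprMn sE mul1r; case: he => ->; rewrite ?mulrN1z ?sqrrN expr1n.
have n1 := nz k (eta ^+ k) k0 (sE k).
have n2 := nz (k + l)%N (eta ^+ (k + l) * e%:~R) (ltn_addl k l0) (sE' _).
have p0 : \prod_(i < k) q ^+ (4 * (i + 0)).+1 != 0.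
  by apply/prodf_neq0 => i _; rewrite expf_neq0.
have [d1 d2 d3] : [/\ qfact (x ^+ 2) k != 0, qfact (x ^+ 2) l != 0 & qfact (x ^+ 2) (k + l) != 0].
  by split; apply: qfact_neq0.
rewrite -ce pE in f1; rewrite /qbin leq_addr addKn.
move: f1 f2 n1 n2 p0 d1 d2 d3; rewrite expr0.
move: (qfact _ _) (qfact _ k) (qfact _ l) (\prod_(i < k) _) (q ^+ _) => Dn Dk Dl p Q.
move: (1 + eta ^+ k * _) (1 + _ ^+ (k + l) * _ * _) (1 + _ ^+ l * _ * _) => T U V.
move: (_%:~R) => Phi f1 f2 T0 U0 p0 Dk0 Dl0 Dn0.
have PhiE := canRL (mulfK T0) f2.
have h2 : (2 : R) != 0 by apply: lt0r_neq0; lra.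
have Phi0 : Phi * U != 0.
  by rewrite mulf_neq0 // PhiE !mulf_neq0 ?invr_eq0 // -[1 + 1]/(2 : R).
apply: (mulIf Phi0); rewrite mulrA f1 PhiE; field.
by rewrite T0 U0 Dk0 Dl0.
Qed.

Variables (delta : F).
Hypothesis hdelta : ~ exists z : F, z ^+ 2 = delta.

(** The type [s] survives only in [E], the character of the discriminant. The estimates ask no more
    of it than E^2 = 1, so they treat both types alike. *)
Lemma num_sqrt1_Omega_closed (s : sgn) n : (1 < n)%N ->
  exists m : nat, exists E : R, [/\ (m <= 2)%N, E ^+ 2 = 1 &
    (num_sqrt1 (Omega delta s n))%:R = m%:R + \sum_(1 <= k < n)
      q ^+ (4 * k * (n - k)) * (1 / 2 * qbin (x ^+ 2) n k *
        ((1 + (eta ^+ (n - k) * E) * x ^+ (n - k)) * (1 + eta ^+ k * x ^+ k)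
          / (1 + (eta ^+ n * E) * x ^+ n)))].
Proof.
move=> n1; have [S [sS uS qS]] := qform_gram hodd hdelta s n1.
have [m m2 ->] := num_sqrt1_Omega hodd n1 sS uS qS.
have dS : \det S != 0 by rewrite -unitfE -unitmxE.
have he := qchar_pm dS.
exists m, (qchar (\det S))%:~R; split=> //.
  by case: he => ->; rewrite ?mulrN1z ?sqrrN expr1n.
rewrite natrD natr_sum; congr (_ + _); apply: eq_big_nat => k /andP[k0 kn].
have [l nE] : exists l, n = (k + l)%N by exists (n - k)%N; rewrite subnKC // ltnW.
have dE : (n.*2.-1.+1 = n.*2)%N by rewrite prednK // double_gt0 ltnW.
have l0 : (0 < l)%N by move: kn; rewrite nE -{1}[k]addn0 ltn_add2l.
have kE : (n - k = l)%N by rewrite nE addKn.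
have h1 : #|frames k.*2 (1%:M : 'M[F]_k.*2)|%:Z = frame_count k 0 1.
  rewrite card_frames ?trmx1 ?unitmx1 // det1 qchar1 // /frame_count.
  by apply: eq_bigr => i _; rewrite addn0.
have h2 : #|frames k.*2 S|%:Z = frame_count k l (qchar (\det S)).
  rewrite card_frames //; first by apply: eq_bigr => i _; rewrite -nE; congr (sphere F (_ - _) _).
  by rewrite dE leq_double ltnW.
have := card_frame_invols hodd k.*2 sS uS => /(congr1 Posz).
rewrite PoszM h1 h2; move: #|_| => c h3.
move: (qchar (\det S)) he h3 {h2} => e he h3; rewrite kE nE.
by apply: (card_frame_invols_closed k0 l0 he); rewrite -h3 intrM -pmulrn.
Qed.

End InvolutionCount.

(** * Explicit error bound *)

Section MainEstimate.

Variables (R : realFieldType) (F : finFieldType) (delta : F).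
Hypothesis hodd : odd #|F|.
Hypothesis hdelta : ~ exists z : F, z ^+ 2 = delta.

Let q : R := #|F|%:R.
Let x := q^-1.

(** Each of the n - 1 inner terms is off by at most 20 (x^k + x^(n-k)) x^((n-2k)^2), hence by 40
    x^(n/2); the two end terms together add one more x^(n/2). The total is below 41 n x^(n/2). *)
Lemma num_sqrt1_Omega_estimate (s : sgn) n : (1 < n)%N ->
  `|(num_sqrt1 (Omega delta s n))%:R / q ^+ (n ^ 2)
    - 1 / 4 * (\prod_(1 <= i < n.+1) (1 + 1 / q ^+ (2 * i - 1)) ^+ 2
       + (-1) ^+ n * \prod_(1 <= i < n.+1) (1 - 1 / q ^+ (2 * i - 1)) ^+ 2)|
  <= 41 * n%:R * x ^+ n./2.
Proof.
move=> n1; have q2 : 2 <= q := card_field_ge2 R F.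
have q0 : q != 0 by apply: lt0r_neq0; lra.
have n0 : (0 < n)%N := ltnW n1.
have [m [E [m2 E2 ->]]] := num_sqrt1_Omega_closed R hodd hdelta s n1.
rewrite -/q -/x.
have tp := triple_product_even q2 n.
rewrite [1 / 4 * _](_ : _ = 1 / 2 * (1 / 2 * (\prod_(1 <= i < n.+1) (1 + 1 / q ^+ (2 * i - 1)) ^+ 2
  + (-1) ^+ n * \prod_(1 <= i < n.+1) (1 - 1 / q ^+ (2 * i - 1)) ^+ 2))); last by field.
rewrite -tp -/x {tp}.
have xb k : 0 < x ^+ k <= 1 := exprn_half_bounds q2 k.
have y0 : 0 < x ^+ 2 by case/andP: (xb 2%N).
have y4 : x ^+ 2 <= 1 / 4.
  by have := exprn_le_half q2 (isT : (0 < 1)%N); rewrite -/x expr1; move: y0 (xb 1%N); rewrite expr1 expr2; nra.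
have wE k : (k <= n)%N -> q ^+ (4 * k * (n - k)) / q ^+ (n ^ 2) = x ^+ sqr_gap n k.
  move=> kn; rewrite -(sqr_gapE kn) exprD invfM mulrA divff ?expf_neq0 //.
  by rewrite mul1r exprVn.
(* The terms k = 0 and k = n, each equal to x^(n^2), are set apart to be compared with the
   undetermined [m]. *)
have -> : \sum_(k < n.+1) qbin (x ^+ 2) n.*2 k.*2 * (q ^+ (4 * k * (n - k)) / q ^+ (n ^ 2))
    = 2 * x ^+ (n ^ 2) + \sum_(1 <= k < n) qbin (x ^+ 2) n.*2 k.*2 * x ^+ sqr_gap n k.
  rewrite -(big_mkord xpredT (fun k => qbin (x ^+ 2) n.*2 k.*2 * (q ^+ (4 * k * (n - k)) / q ^+ (n ^ 2)))).
  rewrite big_nat_recr // big_ltn //= !double0 !(qbin0 y0 y4) !(qbinn y0 y4) subnn !muln0 mul0n.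
  rewrite expr0 !mul1r addrAC -mulr2n mulr_natl; congr (_ + _); first by rewrite exprVn.
  by apply: eq_big_nat => k /andP[_ kn]; rewrite wE // ltnW.
have xn2 : x ^+ (n ^ 2) <= x ^+ n./2.
  have [r ->] : exists r, (n ^ 2 = n./2 + r)%N.
    by exists (n ^ 2 - n./2)%N; rewrite subnKC // -divn2 (leq_trans (leq_div _ _)) // -mulnn leq_pmulr.
  by rewrite exprD ler_piMr //; move: (xb n./2) (xb r); lra.
rewrite mulrDl mulr_suml mulrDr mulr_sumr mulrA -exprVn -/x.
rewrite (_ : 1 / 2 * 2 = 1); last by field.
rewrite opprD addrACA -sumrB mul1r.
apply: le_trans (ler_normD _ _) _.
have mb : `|m%:R * x ^+ (n ^ 2) - x ^+ (n ^ 2)| <= x ^+ n./2.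
  have : m%:R <= 2 :> R by rewrite ler_nat.
  have : 0 <= m%:R :> R by rewrite ler0n.
  move: xn2 (xb (n ^ 2)%N); move: (x ^+ _) (x ^+ _) (m%:R) => a b c ab /andP[a0 _] c0 c2.
  by rewrite ler_norml; apply/andP; split; nra.
have sb : `|\sum_(1 <= k < n) (q ^+ (4 * k * (n - k)) * (1 / 2 * qbin (x ^+ 2) n k *
        ((1 + ((qchar (-1 : F))%:~R ^+ (n - k) * E) * x ^+ (n - k)) * (1 + (qchar (-1 : F))%:~R ^+ k * x ^+ k)
          / (1 + ((qchar (-1 : F))%:~R ^+ n * E) * x ^+ n))) * x ^+ (n ^ 2)
     - 1 / 2 * (qbin (x ^+ 2) n.*2 k.*2 * x ^+ sqr_gap n k))|
   <= \sum_(1 <= k < n) 40 * x ^+ n./2.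
  apply: le_trans (ler_norm_sum _ _ _) _; apply: ler_sum_nat => k /andP[k0 kn].
  have kn' := ltnW kn; have [h1 h2] := half_le_sqr_gap kn'; have := wE k kn'.
  have l0 : (0 < n - k)%N by rewrite subn_gt0.
  rewrite -exprVn -/x => we.
  rewrite mulrAC we [1 / 2 * (_ * _)]mulrA [1 / 2 * _ * x ^+ _]mulrC -mulrBr normrM.
  have [l nE] : exists l, n = (k + l)%N by exists (n - k)%N; rewrite subnKC.
  have kl : (n - k)%N = l by rewrite nE addKn.
  rewrite kl in l0 h2 *.
  have eta1 i : `|(qchar (-1 : F))%:~R ^+ i : R| <= 1.
    rewrite normrX; case: (@qchar_pm F (-1)) => [|->|->]; rewrite ?oppr_eq0 ?oner_neq0 //.
      by rewrite normr1 expr1n.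
    by rewrite mulrN1z normrN1 expr1n.
  have E1 : `|E| <= 1 by move/eqP: E2; rewrite sqrf_eq1 => /orP[] /eqP ->; rewrite ?normrN1 ?normr1.
  have := frame_ratio_close q2 (s := (qchar (-1 : F))%:~R ^+ l * E) (t := (qchar (-1 : F))%:~R ^+ k)
    (u := (qchar (-1 : F))%:~R ^+ n * E) k0 l0.
  rewrite -/x -nE !normrM !mulr_ile1 ?normr_ge0 // eta1 => /(_ isT isT isT).
  move=> tc; rewrite ger0_norm; last by case/andP: (xb (sqr_gap n k)) => /ltW.
  apply: (@le_trans _ _ (x ^+ sqr_gap n k * (20 * (x ^+ k + x ^+ l)))).
    by rewrite ler_wpM2l //; case/andP: (xb (sqr_gap n k)) => /ltW.
  have pw i : (n./2 <= i)%N -> x ^+ i <= x ^+ n./2.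
    move=> ni; rewrite -(subnKC ni) exprD ler_piMr //; move: (xb n./2) (xb (i - n./2)%N); lra.
  have := pw _ h1; have := pw _ h2; rewrite !exprD.
  by move: (x ^+ sqr_gap n k) (x ^+ k) (x ^+ l) (x ^+ n./2) => *; lra.
apply: le_trans (lerD mb sb) _.
have nE : n%:R = n.-1%:R + 1 :> R by rewrite natr1 prednK.
rewrite sumr_const_nat -mulr_natl subn1 nE.
by move: (xb n./2) (ler0n R n.-1); nra.
Qed.

End MainEstimate.

(* Passage to the limit *)
From mathcomp Require Import all_classical all_reals all_analysis.
Import numFieldNormedType.Exports.
Local Open Scope classical_set_scope.
Local Open Scope ring_scope.

Section Limits.

Variable R : realType.

(** [a m] stands for 2m or 2m + 1. The linear factor is absorbed by (3/2)^m against x^m <= (1/2)^m,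
    leaving the geometric bound 164 (3/4)^m with 164 = 41 times 4. *)
Lemma cvg_estimate (u v : nat -> R) (a : nat -> nat) (x l : R) :
  0 < x <= 1 / 2 -> (forall m, (a m)./2 = m) ->
  (forall m, (1 < a m)%N -> `|u m - v m| <= 41 * (a m)%:R * x ^+ (a m)./2) ->
  v @ \oo --> l -> u @ \oo --> l.
Proof.
move=> /andP[x0 x2] ha uv vl.
have -> : u = (fun m => v m + (u m - v m)) by apply/funext => m; rewrite addrCA subrr addr0.
rewrite -[l]addr0; apply: cvgD => //.
have g0 : geometric (164 : R) (3 / 4) @ \oo --> (0 : R).
  by apply: cvg_geometric; rewrite ger0_norm; lra.
apply: (@squeeze_cvgr _ _ _ _ (fun m => - geometric (164 : R) (3 / 4) m) (geometric 164 (3 / 4))) => //.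
  exists 1%N => //= m m1; rewrite -ler_norml.
  have am : a m = (odd (a m) + m.*2)%N by rewrite -[LHS]odd_double_half ha.
  have a1 : (1 < a m)%N by rewrite am (leq_trans _ (leq_addl _ _)) // -[2%N]/(1.*2)%N leq_double.
  apply: le_trans (uv m a1) _.
  rewrite ha /geometric /=.
  have an : (a m)%:R <= 2 * m%:R + 4 :> R.
    by rewrite -natrM -natrD ler_nat am; case: (odd _); lia.
  (* The generous constant 4 makes the induction work: multiplying 2k + 4 by 3/2 gains k + 2, which
     is at least the required 2. *)
  have pw : 2 * m%:R + 4 <= 4 * (3 / 2) ^+ m :> R.
    elim: (m) => [|k IH]; first by rewrite expr0; lra.
    have kE : k.+1%:R = k%:R + 1 :> R by rewrite natr1.
    by rewrite exprS kE; have := ler0n R k; move: IH; move: (_ ^+ k) => c; lra.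
  have -> : 164 * (3 / 4) ^+ m = 41 * (4 * (3 / 2) ^+ m) * (1 / 2) ^+ m :> R.
    rewrite -[41 * _ * _]mulrA -[4 * _ * _]mulrA -exprMn.
    by rewrite (_ : 3 / 2 * (1 / 2) = 3 / 4 :> R); [ring|field].
  apply: ler_pM; first by rewrite mulr_ge0 ?ler0n.
  - by rewrite exprn_ge0 ?ltW.
  - by rewrite ler_pM2l ?(le_trans an pw).
  by apply: lerXn2r => //; rewrite nnegrE; lra.
by rewrite -[X in _ --> X]oppr0; apply: cvgN.
Qed.

Lemma cvg_subseq_nat (a : nat -> nat) (f : nat -> R) (l : R) :
  (forall m, (m <= a m)%N) -> f @ \oo --> l -> f \o a @ \oo --> l.
Proof.
move=> ha fl; apply: cvg_comp fl => A [N _ NA]; exists N => // m /= Nm.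
by apply: NA => /=; apply: leq_trans (ha m).
Qed.

End Limits.

Theorem theorem7p4 (R : realType) (F : finFieldType) (delta : F)
    (hodd : odd #|F|) (hdelta : ~ exists x : F, x ^+ 2 = delta) (s : sgn) :
  let q : R := #|F|%:R in
  ((fun m : nat => (num_sqrt1 (Omega delta s (2 * m)))%:R / q ^+ ((2 * m) ^ 2))
     @ \oo -->
     (1 / 4 * (infprod (fun i => (1 + 1 / q ^+ (2 * i - 1)) ^+ 2)
               + infprod (fun i => (1 - 1 / q ^+ (2 * i - 1)) ^+ 2)) : R))
  /\
  ((fun m : nat =>
      (num_sqrt1 (Omega delta s (2 * m + 1)))%:R / q ^+ ((2 * m + 1) ^ 2))
     @ \oo -->
     (1 / 4 * (infprod (fun i => (1 + 1 / q ^+ (2 * i - 1)) ^+ 2)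
               - infprod (fun i => (1 - 1 / q ^+ (2 * i - 1)) ^+ 2)) : R)).
Proof.
move=> q; have q2 : 2 <= q := card_field_ge2 R F.
have x02 : 0 < q^-1 <= 1 / 2.
  by rewrite invr_gt0 -div1r ler_pdivrMr; lra.
(* One family for both products, so that the estimate reads P 1 n + (-1)^n P (-1) n. *)
pose P (e : R) N : R := \prod_(1 <= i < N.+1) (1 + e * (1 / q ^+ (2 * i - 1))) ^+ 2.
have P1 : P 1 @ \oo --> infprod (fun i => (1 + 1 / q ^+ (2 * i - 1)) ^+ 2).
  have -> : P 1 = fun N => \prod_(1 <= i < N.+1) (1 + 1 / q ^+ (2 * i - 1)) ^+ 2.
    by apply/funext => N; apply: eq_bigr => i _; rewrite mul1r.
  exact: infprod_plus_cvg.
have PN1 : P (-1) @ \oo --> infprod (fun i => (1 - 1 / q ^+ (2 * i - 1)) ^+ 2).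
  have -> : P (-1) = fun N => \prod_(1 <= i < N.+1) (1 - 1 / q ^+ (2 * i - 1)) ^+ 2.
    by apply/funext => N; apply: eq_bigr => i _; rewrite mulN1r.
  exact: infprod_minus_cvg.
have est n : (1 < n)%N -> `|(num_sqrt1 (Omega delta s n))%:R / q ^+ (n ^ 2)
    - 1 / 4 * (P 1 n + (-1) ^+ n * P (-1) n)| <= 41 * n%:R * q^-1 ^+ n./2.
  move=> n1; have := num_sqrt1_Omega_estimate R hodd hdelta s n1; rewrite -/q.
  have -> : P 1 n = \prod_(1 <= i < n.+1) (1 + 1 / q ^+ (2 * i - 1)) ^+ 2.
    by apply: eq_bigr => i _; rewrite mul1r.
  have -> // : P (-1) n = \prod_(1 <= i < n.+1) (1 - 1 / q ^+ (2 * i - 1)) ^+ 2.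
  by apply: eq_bigr => i _; rewrite mulN1r.
(* The two limits differ only in the sign (-1)^n, which is 1 for n = 2m and -1 for n = 2m + 1. *)
split.
  apply: (cvg_estimate (v := fun m => 1 / 4 * (P 1 (2 * m)%N + P (-1) (2 * m)%N))
    (a := fun m => (2 * m)%N) x02).
  - by move=> m; rewrite mul2n doubleK.
  - by move=> m /est; rewrite -signr_odd oddM /= expr0 [1 * P _ _]mul1r.
  apply: cvgMr; apply: cvgD.
    by apply: (@cvg_subseq_nat R (fun m => 2 * m)%N (P 1)) => // m; rewrite leq_pmull.
  by apply: (@cvg_subseq_nat R (fun m => 2 * m)%N (P (-1))) => // m; rewrite leq_pmull.
apply: (cvg_estimate (v := fun m => 1 / 4 * (P 1 (2 * m + 1)%N - P (-1) (2 * m + 1)%N))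
  (a := fun m => (2 * m + 1)%N) x02).
- by move=> m; rewrite mul2n addn1 /= uphalf_double.
- by move=> m /est; rewrite -signr_odd oddD oddM /= expr1 mulN1r.
have le m : (m <= 2 * m + 1)%N by lia.
apply: cvgMr; apply: cvgB.
  exact: (@cvg_subseq_nat R (fun m => 2 * m + 1)%N (P 1)).
exact: (@cvg_subseq_nat R (fun m => 2 * m + 1)%N (P (-1))).
Qed.
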